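(* For every $K\in\mathbb{N}^*$ with $K\ge2$ and every $n\in\mathbb{N}^*$, there exists a real-valued $\mu\in C_c^\infty(0,1)$ satisfying (H1)$_K$ and (H2)$_{K,n}$.
   Context: $\varphi_j=\sqrt2\sin(j\pi x)$, $\lambda_j=(j\pi)^2$, $\langle f,g\rangle=\int_0^1f\bar g$. (H1)$_K$: $\langle\mu\varphi_1,\varphi_K\rangle=0$. (H2)$_{K,n}$: with $c_j=\langle\mu\varphi_1,\varphi_j\rangle\langle\mu\varphi_K,\varphi_j\rangle$, $\sum_jj^{4n}|c_j|<\infty$, and with $A^p_K=(-1)^{p-1}\sum_{j}(\lambda_j-\frac{\lambda_1+\lambda_K}2)(\lambda_K-\lambda_j)^{p-1}(\lambda_j-\lambda_1)^{p-1}c_j$, $A^p_K=0$ for $1\le p\le n-1$ and $A^n_K\ne0$. *)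

(* Defs.v *)
From Stdlib Require Import Reals.
From Coquelicot Require Import Coquelicot.
Open Scope R_scope.

(* Dirichlet eigenfunctions / eigenvalues on (0,1). *)
Definition phi (j : nat) (x : R) : R := sqrt 2 * sin (INR j * PI * x).
Definition lam (j : nat) : R := (INR j * PI) ^ 2.

Definition ip (f g : R -> R) : R := RInt (fun x => f x * g x) 0 1.

Definition smooth (f : R -> R) : Prop :=
  forall (k : nat) (x : R), ex_derive (Derive_n f k) x.

Definition compact_support_in_01 (f : R -> R) : Prop :=
  exists a b : R, 0 < a /\ a <= b /\ b < 1 /\
    forall x, (x < a \/ b < x) -> f x = 0.

Definition H1 (mu : R -> R) (K : nat) : Prop :=
  ip (fun x => mu x * phi 1 x) (phi K) = 0.

Definition cc (mu : R -> R) (K j : nat) : R :=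
  ip (fun x => mu x * phi 1 x) (phi j) * ip (fun x => mu x * phi K x) (phi j).

Definition A (mu : R -> R) (K p : nat) : R :=
  (-1) ^ (p - 1) *
  Series (fun k : nat =>
    let j := S k in
    (lam j - (lam 1 + lam K) / 2) * (lam K - lam j) ^ (p - 1)
      * (lam j - lam 1) ^ (p - 1) * cc mu K j).

Definition H2 (mu : R -> R) (K n : nat) : Prop :=
  ex_series (fun k : nat => INR (S k) ^ (4 * n) * Rabs (cc mu K (S k))) /\
  (forall p : nat, (1 <= p)%nat -> (p <= n - 1)%nat -> A mu K p = 0) /\
  A mu K n <> 0.

(* Main.v *)
Require Import Defs.
From Stdlib Require Import Reals Lra Lia List FunctionalExtensionality Classical.
From Coquelicot Require Import Coquelicot.
Open Scope R_scope.

(* With [T_a g = - g'' - a g], whose effect on the [j]-th sine coefficient is multiplication by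
   [lam j - a], Parseval turns [A mu K p] into the integral over (0,1) of
   [(T_m T_{lam K}^{p-1} T_{lam 1}^{p-1} (mu phi_1)) * (mu phi_K)], with [m] the midpoint of
   [lam 1] and [lam K].  This is a quadratic form in [mu], additive over pieces of disjoint
   support.  For a bump of width [1/s] at [x0] it is
   [s^(4p-3) * (phi_1 phi_K)(x0) * (positive constant)] up to a relative error [O(1/s)], so the
   form of index [n] dominates all lower ones and has the sign of [phi_1 phi_K] at [x0].  As
   [K >= 2], both signs occur; the lower forms are then cancelled one after the other by adding
   pieces of disjoint support and of suitable sign, and the linear condition (H1) is met by
   combining two such solutions of disjoint support. *)

(** * Smooth functions and a smooth bump *)

(** Why the elimination takes the form it does: scaling a piece by [t] multiplies its forms by
    [t ^ 2], so a correction can push a form only towards its own sign. Correcting pieces of both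
    signs are therefore required, and each piece is allowed to live on two intervals, one where
    [phi_1 phi_K] is positive and one where it is negative. A correction that kills one form also
    disturbs all higher ones, including the form of index [n] that has to stay nonzero. The order of
    choices resolves this: the correcting pieces come first, the ratios between their forms are then
    known numbers, and the main piece is chosen last, with an [n]-th form large enough to absorb
    them. Hence the domination factor [M] is arbitrary in the induction. For (H1), a nontrivial
    combination [a f + b g] in the kernel of a linear functional always exists; its [n]-th form is
    [a ^ 2 A f + b ^ 2 A g] with both values positive, so it cannot vanish. *)

Fixpoint Ck (n : nat) (f : R -> R) : Prop :=
  match n with
  | O => True
  | S m => (forall x, ex_derive f x) /\ Ck m (Derive f)
  end.

Lemma Derive_n_Derive (f : R -> R) (k : nat) :
  Derive_n (Derive f) k = Derive_n f (S k).
Proof. induction k as [|k IH]; [reflexivity|]. simpl in *. now rewrite IH. Qed.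

(** [Ck] strips derivatives from the inside, so closure under sums, products and affine
    substitutions follows by induction on the order with the functions kept general. *)
Lemma smooth_Ck (f : R -> R) : smooth f <-> forall n, Ck n f.
Proof.
  split.
  - intros H n; revert f H; induction n as [|n IH]; intros f H; simpl; auto.
    split; [exact (H O)|]. apply IH. intros k x. rewrite Derive_n_Derive. apply H.
  - intros H k; revert f H; induction k as [|k IH]; intros f H x.
    + apply (H 1%nat).
    + rewrite <- Derive_n_Derive. apply IH. intros n. apply (H (S n)).
Qed.

Lemma smooth_Derive (f : R -> R) : smooth f -> smooth (Derive f).
Proof. intros H k x. rewrite Derive_n_Derive. apply H. Qed.

Lemma smooth_Derive_n (f : R -> R) (k : nat) : smooth f -> smooth (Derive_n f k).
Proof. intros H; induction k as [|k IH]; auto. simpl. now apply smooth_Derive. Qed.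

Lemma smooth_ex_derive (f : R -> R) (x : R) : smooth f -> ex_derive f x.
Proof. intros H. apply (H O). Qed.

Lemma smooth_is_derive (f : R -> R) (x : R) : smooth f -> is_derive f x (Derive f x).
Proof. intros H. now apply Derive_correct, smooth_ex_derive. Qed.

Lemma smooth_continuous (f : R -> R) (x : R) : smooth f -> continuous f x.
Proof. intros H. now apply (ex_derive_continuous (V := R_NormedModule)), smooth_ex_derive. Qed.

Lemma Ck_const (n : nat) : forall c : R, Ck n (fun _ => c).
Proof.
  induction n as [|n IH]; intros c; simpl; auto. split; [intros; apply ex_derive_const|].
  replace (Derive (fun _ => c)) with (fun _ : R => 0); auto.
  apply functional_extensionality; intros x. now rewrite Derive_const.
Qed.

Lemma Ck_plus (n : nat) : forall f g, Ck n f -> Ck n g -> Ck n (fun x => f x + g x).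
Proof.
  induction n as [|n IH]; simpl; auto. intros f g [Hf Hf'] [Hg Hg'].
  split; [intros x; now apply @ex_derive_plus|].
  replace (Derive (fun x => f x + g x)) with (fun x => Derive f x + Derive g x); auto.
  apply functional_extensionality; intros x. now rewrite Derive_plus.
Qed.

Lemma Ck_weaken (n : nat) : forall f, Ck (S n) f -> Ck n f.
Proof. induction n as [|n IH]; intros f [H1 H2]; simpl; auto. Qed.

Lemma Ck_mult (n : nat) : forall f g, Ck n f -> Ck n g -> Ck n (fun x => f x * g x).
Proof.
  induction n as [|n IH]; [now simpl|]. intros f g Hf Hg.
  pose proof (Ck_weaken _ _ Hf). pose proof (Ck_weaken _ _ Hg).
  destruct Hf as [Hf Hf'], Hg as [Hg Hg'].
  split; [intros x; now apply ex_derive_mult|].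
  replace (Derive (fun x => f x * g x)) with (fun x => Derive f x * g x + f x * Derive g x).
  - apply Ck_plus; now apply IH.
  - apply functional_extensionality; intros x. now rewrite Derive_mult.
Qed.

Lemma smooth_const (c : R) : smooth (fun _ => c).
Proof. apply smooth_Ck; intros n; apply Ck_const. Qed.

Lemma smooth_plus (f g : R -> R) : smooth f -> smooth g -> smooth (fun x => f x + g x).
Proof. rewrite !smooth_Ck. intros Hf Hg n. now apply Ck_plus. Qed.

Lemma smooth_mult (f g : R -> R) : smooth f -> smooth g -> smooth (fun x => f x * g x).
Proof. rewrite !smooth_Ck. intros Hf Hg n. now apply Ck_mult. Qed.

Lemma smooth_scal (c : R) (f : R -> R) : smooth f -> smooth (fun x => c * f x).
Proof. intros H. apply smooth_mult; auto using smooth_const. Qed.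

Lemma is_derive_affine (f : R -> R) (s t x l : R) :
  is_derive f (s * (x - t)) l -> is_derive (fun y => f (s * (y - t))) x (s * l).
Proof.
  intros H. apply (is_derive_comp f (fun y => s * (y - t))); auto.
  auto_derive; auto; ring.
Qed.

Lemma Derive_affine (f : R -> R) (s t : R) : smooth f ->
  Derive (fun y => f (s * (y - t))) = (fun y => s * Derive f (s * (y - t))).
Proof.
  intros H. apply functional_extensionality; intros x.
  apply is_derive_unique, is_derive_affine. now apply smooth_is_derive.
Qed.

Lemma smooth_affine (f : R -> R) (s t : R) : smooth f -> smooth (fun x => f (s * (x - t))).
Proof.
  intros H. apply smooth_Ck. intros n. revert f H. induction n as [|n IH]; simpl; auto.
  intros f H. split.
  - intros x. eexists. apply is_derive_affine. now apply smooth_is_derive.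
  - rewrite Derive_affine by auto. apply Ck_mult; [apply Ck_const|].
    apply IH. now apply smooth_Derive.
Qed.

Lemma Derive_trig (a b w : R) :
  Derive (fun x => a * sin (w * x) + b * cos (w * x))
  = (fun x => - (w * b) * sin (w * x) + w * a * cos (w * x)).
Proof.
  apply functional_extensionality; intros x. apply is_derive_unique.
  auto_derive; auto; ring.
Qed.

Lemma smooth_trig (a b w : R) : smooth (fun x => a * sin (w * x) + b * cos (w * x)).
Proof.
  apply smooth_Ck. intros n. revert a b. induction n as [|n IH]; simpl; auto.
  intros a b. split; [intros x; auto_derive; auto|]. rewrite Derive_trig. apply IH.
Qed.

Lemma phi_trig (j : nat) :
  phi j = (fun x => sqrt 2 * sin (INR j * PI * x) + 0 * cos (INR j * PI * x)).
Proof. apply functional_extensionality; intros x. unfold phi. ring. Qed.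

Lemma smooth_phi (j : nat) : smooth (phi j).
Proof. rewrite phi_trig. apply smooth_trig. Qed.

(* The powers of [/ x] make the family closed under [Derive], up to linear combinations. *)
Definition psi (k : nat) (x : R) : R :=
  if Rlt_dec 0 x then (/ x) ^ k * exp (- / x) else 0.

Lemma pow_le_exp (m : nat) (y : R) : 0 <= y -> y ^ m <= INR (Factorial.fact m) * exp y.
Proof.
  intros Hy. pose proof (INR_fact_lt_0 m) as Hf.
  assert (y ^ m / INR (Factorial.fact m) <= exp y).
  { eapply Rle_trans; [|apply (exp_ge_taylor y m Hy)].
    assert (P : forall k, 0 <= y ^ k / INR (Factorial.fact k)).
    { intros k. apply Rdiv_le_0_compat; [now apply pow_le|apply INR_fact_lt_0]. }
    destruct m as [|m]; [simpl; lra|]. rewrite tech5.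
    pose proof (cond_pos_sum (fun k => y ^ k / INR (Factorial.fact k)) m P). lra. }
  replace (y ^ m) with (INR (Factorial.fact m) * (y ^ m / INR (Factorial.fact m))) by (field; lra).
  apply Rmult_le_compat_l; lra.
Qed.

(** This is [pow_le_exp] at [/ x] with exponent [k + 2]. The two spare powers leave the factor
    [x ^ 2], which forces the difference quotient at [0] to tend to [0]. *)
Lemma psi_bound (k : nat) (x : R) : Rabs (psi k x) <= INR (Factorial.fact (k + 2)) * x ^ 2.
Proof.
  unfold psi. destruct (Rlt_dec 0 x) as [Hx|Hx].
  - assert (Hy : 0 < / x) by now apply Rinv_0_lt_compat.
    pose proof (pow_le_exp (k + 2) (/ x) (Rlt_le _ _ Hy)) as H.
    rewrite Rabs_pos_eq; [|apply Rmult_le_pos; [apply pow_le; lra|apply Rlt_le, exp_pos]].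
    rewrite exp_Ropp. pose proof (exp_pos (/ x)) as He.
    replace ((/ x) ^ k * / exp (/ x)) with ((/ x) ^ (k + 2) * (x ^ 2 * / exp (/ x)))
      by (rewrite pow_add; field; lra).
    replace (INR (Factorial.fact (k + 2)) * x ^ 2)
      with (INR (Factorial.fact (k + 2)) * exp (/ x) * (x ^ 2 * / exp (/ x))) by (field; lra).
    apply Rmult_le_compat_r; auto.
    apply Rmult_le_pos; [apply pow2_ge_0|apply Rlt_le; now apply Rinv_0_lt_compat].
  - rewrite Rabs_R0. apply Rmult_le_pos; [apply pos_INR|apply pow2_ge_0].
Qed.

Lemma is_derive_psi (k : nat) (x : R) :
  is_derive (psi k) x (psi (S (S k)) x + - INR k * psi (S k) x).
Proof.
  destruct (Rtotal_order x 0) as [Hx|[Hx|Hx]].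
  - apply (is_derive_ext_loc (fun _ => 0)).
    + exists (mkposreal (- x) ltac:(lra)). intros y Hy. unfold psi.
      destruct (Rlt_dec 0 y); auto. apply Rabs_lt_between in Hy.
      change (minus y x) with (y - x) in Hy. simpl in Hy. lra.
    + unfold psi. destruct (Rlt_dec 0 x); [lra|].
      replace (0 + - INR k * 0) with 0 by ring. apply @is_derive_const.
  - subst x. replace (_ + _) with 0
      by (unfold psi; destruct (Rlt_dec 0 0); [lra|ring]).
    apply is_derive_Reals. intros eps Heps.
    assert (HC : 0 < INR (Factorial.fact (k + 2))) by apply INR_fact_lt_0.
    assert (Hd : 0 < eps / INR (Factorial.fact (k + 2))) by now apply Rdiv_lt_0_compat.
    exists (mkposreal _ Hd). intros h Hh Hlt. simpl in Hlt.
    replace (psi k 0) with 0 by (unfold psi; destruct (Rlt_dec 0 0); [lra|auto]).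
    rewrite Rplus_0_l, !Rminus_0_r. rewrite Rabs_div by auto.
    pose proof (psi_bound k h) as B. pose proof (Rabs_pos_lt h Hh) as Hp.
    apply (Rmult_lt_reg_r (Rabs h)); auto. unfold Rdiv at 1.
    rewrite Rmult_assoc, Rinv_l, Rmult_1_r by lra.
    eapply Rle_lt_trans; [exact B|]. rewrite <- pow2_abs.
    replace (INR (Factorial.fact (k + 2)) * Rabs h ^ 2)
      with ((INR (Factorial.fact (k + 2)) * Rabs h) * Rabs h) by ring.
    apply Rmult_lt_compat_r; auto.
    apply (Rmult_lt_compat_l _ _ _ HC) in Hlt.
    replace (INR (Factorial.fact (k + 2)) * (eps / INR (Factorial.fact (k + 2)))) with eps in Hlt by (field; lra).
    exact Hlt.
  - apply (is_derive_ext_loc (fun x => (/ x) ^ k * exp (- / x))).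
    + exists (mkposreal x Hx). intros y Hy. unfold psi.
      destruct (Rlt_dec 0 y); auto. apply Rabs_lt_between in Hy.
      change (minus y x) with (y - x) in Hy. simpl in Hy. lra.
    + unfold psi. destruct (Rlt_dec 0 x); [|lra].
      auto_derive; [lra|]. destruct k as [|k]; [simpl; field; lra|].
      rewrite S_INR. simpl pred. simpl pow. field. lra.
Qed.

Lemma Derive_psi (k : nat) :
  Derive (psi k) = (fun x => psi (S (S k)) x + - INR k * psi (S k) x).
Proof. apply functional_extensionality; intros x. apply is_derive_unique, is_derive_psi. Qed.

Lemma smooth_psi (k : nat) : smooth (psi k).
Proof.
  apply smooth_Ck. intros n. revert k. induction n as [|n IH]; simpl; auto. intros k.
  split; [intros x; eexists; apply is_derive_psi|].
  rewrite Derive_psi. apply Ck_plus; auto. apply Ck_mult; auto using Ck_const.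
Qed.

(** On [(-1, 1)] this is [exp (- / (x + 1)) * exp (- / (1 - x))]. The arguments are spelled
    [s * (x - t)] to match [smooth_affine]. *)
Definition bump (x : R) : R := psi 0 (1 * (x - -1)) * psi 0 (-1 * (x - 1)).

Lemma smooth_bump : smooth bump.
Proof.
  apply (smooth_mult (fun x => psi 0 (1 * (x - -1))) (fun x => psi 0 (-1 * (x - 1))));
    apply smooth_affine, smooth_psi.
Qed.

Lemma bump_out (x : R) : x <= -1 \/ 1 <= x -> bump x = 0.
Proof.
  intros H. unfold bump, psi.
  destruct (Rlt_dec 0 (1 * (x - -1))); destruct (Rlt_dec 0 (-1 * (x - 1))); try ring. lra.
Qed.

Lemma bump_0 : bump 0 <> 0.
Proof.
  unfold bump, psi.
  destruct (Rlt_dec 0 (1 * (0 - -1))); [|lra]. destruct (Rlt_dec 0 (-1 * (0 - 1))); [|lra].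
  simpl. rewrite !Rmult_1_l. apply Rmult_integral_contrapositive_currified;
  apply Rgt_not_eq, exp_pos.
Qed.

(** * Locally vanishing functions *)

(** Vanishing on a neighbourhood, unlike vanishing at a point, is inherited by derivatives. *)
Definition off (f : R -> R) (x : R) : Prop := locally x (fun y => f y = 0).

Lemma off_eq (f : R -> R) (x : R) : off f x -> f x = 0.
Proof. intros H. exact (locally_singleton _ _ H). Qed.

Lemma off_Derive (f : R -> R) (x : R) : off f x -> off (Derive f) x.
Proof.
  unfold off. intros H. apply locally_locally in H. revert H. apply filter_imp. intros y Hy.
  rewrite (Derive_ext_loc f (fun _ => 0) y Hy). apply Derive_const.
Qed.

Lemma off_Derive_n (f : R -> R) (k : nat) (x : R) : off f x -> off (Derive_n f k) x.
Proof. intros H. induction k as [|k IH]; auto. simpl. now apply off_Derive. Qed.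

Lemma off_lin (a b : R) (f g : R -> R) (x : R) :
  off f x -> off g x -> off (fun y => a * f y + b * g y) x.
Proof.
  unfold off. intros Hf Hg. generalize (filter_and _ _ Hf Hg). apply filter_imp.
  intros y [E1 E2]. rewrite E1, E2. ring.
Qed.

Lemma off_mult_l (f g : R -> R) (x : R) : off f x -> off (fun y => f y * g y) x.
Proof. unfold off. apply filter_imp. intros y ->. ring. Qed.

Lemma off_lt (f : R -> R) (b x : R) : (forall y, y < b -> f y = 0) -> x < b -> off f x.
Proof. intros H Hx. generalize (locally_interval (fun y => f y = 0) x m_infty b I Hx).
  intros G. apply G. intros y _ Hy. now apply H. Qed.

Lemma off_gt (f : R -> R) (a x : R) : (forall y, a < y -> f y = 0) -> a < x -> off f x.
Proof. intros H Hx. generalize (locally_interval (fun y => f y = 0) x a p_infty Hx I).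
  intros G. apply G. intros y Hy _. now apply H. Qed.

Lemma bounded_off (f : R -> R) (a b : R) : a <= b -> (forall x, continuous f x) ->
  (forall x, x < a \/ b < x -> f x = 0) -> exists C, 0 <= C /\ forall x, Rabs (f x) <= C.
Proof.
  intros Hab Hc Ho.
  destruct (continuity_ab_maj (fun x => Rabs (f x)) a b Hab) as [m [Hm _]].
  - intros c _. apply continuity_pt_filterlim.
    apply (continuous_comp f Rabs); [apply Hc|apply continuous_Rabs].
  - exists (Rabs (f m)). split; [apply Rabs_pos|]. intros x.
    destruct (Rlt_dec x a) as [H|H]; [rewrite Ho by auto; rewrite Rabs_R0; apply Rabs_pos|].
    destruct (Rlt_dec b x) as [H'|H']; [rewrite Ho by auto; rewrite Rabs_R0; apply Rabs_pos|].
    apply Hm. lra.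
Qed.

(** * Sine series *)

Lemma sum_n_S (a : nat -> R) (n : nat) : sum_n a (S n) = sum_n a n + a (S n) :> R.
Proof. now rewrite sum_Sn. Qed.

Lemma sum_n_0 (a : nat -> R) : sum_n a 0 = a O :> R.
Proof. now rewrite sum_O. Qed.

(** Confined to [[0, 1]] because the quotient built in [divide_by_cos] has a denominator with zeros
    elsewhere, for instance at [- x]. *)
Definition cont01 (f : R -> R) : Prop := forall x, 0 <= x <= 1 -> continuous f x.

Lemma cont01_smooth (f : R -> R) : smooth f -> cont01 f.
Proof. intros H x _. now apply smooth_continuous. Qed.

Lemma cont01_mult (f g : R -> R) : cont01 f -> cont01 g -> cont01 (fun x => f x * g x).
Proof. intros Hf Hg x Hx. apply (continuous_mult (K := R_AbsRing)); auto. Qed.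

Lemma cont01_lin (a b : R) (f g : R -> R) :
  cont01 f -> cont01 g -> cont01 (fun x => a * f x + b * g x).
Proof.
  intros Hf Hg x Hx. apply (continuous_plus (V := R_NormedModule));
  apply (continuous_scal_r (V := R_NormedModule)); auto.
Qed.

Lemma ex_RInt_cont01 (f : R -> R) : cont01 f -> ex_RInt f 0 1.
Proof.
  intros H. apply (ex_RInt_continuous (V := R_CompleteNormedModule)).
  rewrite Rmin_left, Rmax_right by lra. exact H.
Qed.

Lemma RInt_ext_R (f g : R -> R) (a b : R) : a <= b ->
  (forall x, a < x < b -> f x = g x) -> RInt f a b = RInt g a b :> R.
Proof.
  intros Hab H. apply (RInt_ext (V := R_CompleteNormedModule)).
  rewrite Rmin_left, Rmax_right by auto. exact H.
Qed.

Lemma RInt_lin (f g : R -> R) (a b s t : R) : ex_RInt f s t -> ex_RInt g s t ->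
  RInt (fun x => a * f x + b * g x) s t = a * RInt f s t + b * RInt g s t :> R.
Proof.
  intros Hf Hg. apply is_RInt_unique.
  apply (is_RInt_plus (V := R_NormedModule));
  apply (is_RInt_scal (V := R_NormedModule)); now apply (RInt_correct (V := R_CompleteNormedModule)).
Qed.

Lemma RInt_Derive_eq (F f : R -> R) (a b : R) :
  (forall x, is_derive F x (f x)) -> (forall x, continuous f x) ->
  RInt f a b = F b - F a :> R.
Proof.
  intros H Hc. apply is_RInt_unique. apply (is_RInt_derive F f); intros; auto.
Qed.

Lemma ip_comm (f g : R -> R) : ip f g = ip g f.
Proof. unfold ip. apply RInt_ext_R; [lra|]. intros; apply Rmult_comm. Qed.

Lemma ip_ext (f f' g g' : R -> R) :
  (forall x, 0 <= x <= 1 -> f x * g x = f' x * g' x) -> ip f g = ip f' g'.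
Proof.
  intros H. unfold ip. apply RInt_ext_R; [lra|]. intros x Hx. apply H. lra.
Qed.

Lemma ip_lin_l (a b : R) (f g h : R -> R) : cont01 f -> cont01 g -> cont01 h ->
  ip (fun x => a * f x + b * g x) h = a * ip f h + b * ip g h.
Proof.
  intros Hf Hg Hh. unfold ip.
  rewrite <- RInt_lin by (apply ex_RInt_cont01; now apply cont01_mult).
  apply RInt_ext_R; [lra|]. intros; ring.
Qed.

Lemma ip_lin_r (a b : R) (f g h : R -> R) : cont01 f -> cont01 g -> cont01 h ->
  ip h (fun x => a * f x + b * g x) = a * ip h f + b * ip h g.
Proof. intros Hf Hg Hh. rewrite (ip_comm h), ip_lin_l, !(ip_comm h) by auto. reflexivity. Qed.

(** * Orthonormality of the sines, Bessel's inequality, Riemann-Lebesgue *)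

Lemma sin_INR_PI (j : nat) : sin (INR j * PI) = 0.
Proof.
  induction j as [|j IH]; [simpl; rewrite Rmult_0_l; apply sin_0|].
  rewrite S_INR, Rmult_plus_distr_r, Rmult_1_l, sin_plus, IH, sin_PI. ring.
Qed.

Lemma RInt_cos (w : R) : w <> 0 -> RInt (fun x => cos (w * x)) 0 1 = sin w / w :> R.
Proof.
  intros Hw. rewrite (RInt_Derive_eq (fun x => sin (w * x) / w)).
  - rewrite Rmult_0_r, sin_0, Rmult_1_r. field; auto.
  - intros x. auto_derive; auto. field; auto.
  - intros x. apply (ex_derive_continuous (V := R_NormedModule)). auto_derive; auto.
Qed.

Lemma ex_RInt_cos (w : R) : ex_RInt (fun x => cos (w * x)) 0 1.
Proof.
  apply ex_RInt_cont01. intros x _. apply (ex_derive_continuous (V := R_NormedModule)).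
  auto_derive; auto.
Qed.

Lemma sqrt2_sqr : sqrt 2 * sqrt 2 = 2.
Proof. apply sqrt_sqrt; lra. Qed.

Lemma phi_mult (j k : nat) (x : R) : phi j x * phi k x
  = 1 * cos ((INR j - INR k) * PI * x) + (-1) * cos ((INR j + INR k) * PI * x).
Proof.
  unfold phi.
  replace ((INR j - INR k) * PI * x) with (INR j * PI * x - INR k * PI * x) by ring.
  replace ((INR j + INR k) * PI * x) with (INR j * PI * x + INR k * PI * x) by ring.
  rewrite cos_minus, cos_plus.
  transitivity (sqrt 2 * sqrt 2 * sin (INR j * PI * x) * sin (INR k * PI * x)); [ring|].
  rewrite sqrt2_sqr. ring.
Qed.

Lemma sin_sum_PI (j k : nat) : sin ((INR j + INR k) * PI) = 0.
Proof. rewrite <- plus_INR. apply sin_INR_PI. Qed.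

Lemma sin_diff_PI (j k : nat) : sin ((INR j - INR k) * PI) = 0.
Proof.
  replace ((INR j - INR k) * PI) with (INR j * PI - INR k * PI) by ring.
  rewrite sin_minus, !sin_INR_PI. ring.
Qed.

Lemma ip_phi_S (j k : nat) : ip (phi (S j)) (phi (S k)) = if Nat.eq_dec j k then 1 else 0.
Proof.
  assert (P := PI_RGT_0).
  assert (Hs : (INR (S j) + INR (S k)) * PI <> 0).
  { pose proof (pos_INR j). pose proof (pos_INR k). rewrite !S_INR.
    apply Rgt_not_eq, Rmult_lt_0_compat; lra. }
  unfold ip. erewrite RInt_ext_R; [|lra|intros x _; apply phi_mult].
  rewrite RInt_lin by apply ex_RInt_cos. rewrite (RInt_cos _ Hs), sin_sum_PI.
  destruct (Nat.eq_dec j k) as [->|Hne].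
  - rewrite (RInt_ext_R _ (fun _ => 1)); [|lra|].
    + rewrite (RInt_const (V := R_CompleteNormedModule)). change (scal (1 - 0) 1) with ((1 - 0) * 1).
      unfold Rdiv; ring.
    + intros x _. rewrite Rminus_diag, !Rmult_0_l. apply cos_0.
  - rewrite RInt_cos, sin_diff_PI; [unfold Rdiv; ring|].
    + apply Rmult_integral_contrapositive_currified; [|lra].
      apply Rminus_eq_contra. intros E. apply INR_eq in E. lia.
Qed.

Lemma cont01_phi (j : nat) : cont01 (phi j).
Proof. apply cont01_smooth, smooth_phi. Qed.

Lemma ip_sqr_pos (f : R -> R) : cont01 f -> 0 <= ip f f.
Proof.
  intros H. unfold ip. apply RInt_ge_0; [lra|now apply ex_RInt_cont01, cont01_mult|].
  intros x _. apply Rle_0_sqr.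
Qed.

(** What is left of [h] after projecting out the first [N] sine modes. Each step lowers the squared
    norm by one squared coefficient, and its nonnegativity is Bessel's inequality. *)
Fixpoint residual (h : R -> R) (N : nat) : R -> R :=
  match N with
  | O => h
  | S m => fun x => 1 * residual h m x + (- ip h (phi (S m))) * phi (S m) x
  end.

Lemma cont01_residual (h : R -> R) (N : nat) : cont01 h -> cont01 (residual h N).
Proof. intros H. induction N as [|N IH]; auto. apply cont01_lin; auto using cont01_phi. Qed.

Lemma ip_residual_phi (h : R -> R) (N j : nat) : cont01 h -> (N <= j)%nat ->
  ip (residual h N) (phi (S j)) = ip h (phi (S j)).
Proof.
  intros H. induction N as [|N IH]; auto. intros Hj. simpl residual.
  rewrite ip_lin_l by auto using cont01_phi, cont01_residual.
  rewrite IH by lia. rewrite ip_phi_S. destruct (Nat.eq_dec N j); [lia|]. ring.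
Qed.

Lemma ip_residual_S (h : R -> R) (N : nat) : cont01 h ->
  ip (residual h (S N)) (residual h (S N))
  = ip (residual h N) (residual h N) - ip h (phi (S N)) ^ 2.
Proof.
  intros H. pose proof (cont01_residual h N H) as HN. pose proof (cont01_phi (S N)) as Hp.
  simpl residual. rewrite ip_lin_l by (auto; now apply cont01_lin).
  rewrite !ip_lin_r by auto. rewrite (ip_comm (phi (S N)) (residual h N)).
  rewrite ip_residual_phi by auto. rewrite ip_phi_S.
  destruct (Nat.eq_dec N N); [ring|lia].
Qed.

Lemma bessel (h : R -> R) (N : nat) : cont01 h ->
  sum_n (fun k => ip h (phi (S k)) ^ 2) N <= ip h h.
Proof.
  intros H.
  assert (E : ip (residual h (S N)) (residual h (S N))
    = ip h h - sum_n (fun k => ip h (phi (S k)) ^ 2) N).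
  { induction N as [|N IH]; rewrite ip_residual_S by auto.
    - rewrite sum_n_0. reflexivity.
    - rewrite IH, sum_n_S. ring. }
  pose proof (ip_sqr_pos _ (cont01_residual h (S N) H)). lra.
Qed.

Lemma ex_series_nonneg_bounded (a : nat -> R) (M : R) :
  (forall n, 0 <= a n) -> (forall n, sum_n a n <= M) -> ex_series a.
Proof.
  intros Ha HM. destruct (ex_finite_lim_seq_incr (sum_n a) M) as [l Hl]; auto.
  - intros n. rewrite sum_n_S. specialize (Ha (S n)). lra.
  - exists l. exact Hl.
Qed.

Lemma ex_series_bessel (h : R -> R) : cont01 h ->
  ex_series (fun k => ip h (phi (S k)) ^ 2).
Proof.
  intros H. apply (ex_series_nonneg_bounded _ (ip h h)); [intros; apply pow2_ge_0|].
  intros; now apply bessel.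
Qed.

Lemma riemann_lebesgue (h : R -> R) : cont01 h ->
  is_lim_seq (fun k => ip h (phi (S k))) 0.
Proof.
  intros H. apply is_lim_seq_abs_0.
  apply (is_lim_seq_ext (fun k => sqrt (ip h (phi (S k)) ^ 2))).
  - intros n. rewrite <- sqrt_Rsqr_abs. unfold Rsqr. f_equal. ring.
  - rewrite <- sqrt_0. apply is_lim_seq_continuous.
    + apply continuity_pt_sqrt; lra.
    + apply ex_series_lim_0. now apply ex_series_bessel.
Qed.

Lemma coef_bounded (h : R -> R) : cont01 h ->
  exists B, 0 <= B /\ forall k, Rabs (ip h (phi (S k))) <= B.
Proof.
  intros H. exists (sqrt (ip h h)). split; [apply sqrt_pos|]. intros k.
  rewrite <- sqrt_Rsqr_abs. apply sqrt_le_1_alt.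
  eapply Rle_trans; [|apply (bessel h k H)].
  unfold Rsqr. destruct k as [|k]; [rewrite sum_n_0; lra|].
  rewrite sum_n_S.
  assert (0 <= sum_n (fun k => ip h (phi (S k)) ^ 2) k).
  { clear. induction k as [|k IH]; [rewrite sum_n_0; apply pow2_ge_0|].
    rewrite sum_n_S. pose proof (pow2_ge_0 (ip h (phi (S (S k))))).
    simpl in *. lra. }
  simpl in *. lra.
Qed.

(** * Pointwise convergence of the sine series *)

Definition slope (d : R -> R) (x l y : R) : R :=
  if Req_EM_T y x then l else (d y - d x) / (y - x).

Lemma slope_continuous (d : R -> R) (x l : R) :
  (forall y, continuous d y) -> is_derive d x l -> forall y, continuous (slope d x l) y.
Proof.
  intros Hc Hd y. destruct (Req_EM_T y x) as [->|Hne].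
  - apply continuity_pt_filterlim. intros eps Heps.
    apply is_derive_Reals in Hd. destruct (Hd eps Heps) as [del Hdel].
    exists del. split; [apply cond_pos|]. intros z [[_ Hz] Hzx].
    simpl in *. unfold Rdist in *. unfold slope.
    destruct (Req_EM_T z x); [congruence|]. destruct (Req_EM_T x x); [|congruence].
    specialize (Hdel (z - x) ltac:(lra) Hzx).
    replace (x + (z - x)) with z in Hdel by ring. exact Hdel.
  - apply (continuous_ext_loc _ (fun z => (d z - d x) * / (z - x))).
    + assert (Hp : 0 < Rabs (y - x)) by (apply Rabs_pos_lt; lra).
      exists (mkposreal _ Hp). intros z Hz. unfold slope.
      destruct (Req_EM_T z x) as [->|]; [|reflexivity].
      change (Rabs (x - y) < Rabs (y - x)) in Hz. rewrite Rabs_minus_sym in Hz. lra.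
    + apply (continuous_mult (K := R_AbsRing)).
      * apply (continuous_minus (V := R_NormedModule)); [apply Hc|apply continuous_const].
      * apply (ex_derive_continuous (V := R_NormedModule)). auto_derive. lra.
Qed.

Lemma cos_PI_inj (x y : R) : 0 <= x <= 1 -> 0 <= y <= 1 -> y <> x ->
  cos (PI * y) - cos (PI * x) <> 0.
Proof.
  intros Hx Hy Hne. assert (P := PI_RGT_0).
  assert (Bx : 0 <= PI * x <= PI) by (split; nra).
  assert (By : 0 <= PI * y <= PI) by (split; nra).
  destruct (Rtotal_order x y) as [H|[H|H]]; [|congruence|].
  - assert (PI * x < PI * y) by nra.
    pose proof (cos_decreasing_1 (PI * x) (PI * y)). lra.
  - assert (PI * y < PI * x) by nra.
    pose proof (cos_decreasing_1 (PI * y) (PI * x)). lra.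
Qed.

(** On [[0, 1]] the function [cos (PI * y) - cos (PI * x)] has its only zero at [x], and it is
    simple because [sin (PI * x)] is nonzero. Dividing numerator and denominator by [y - x] turns
    the quotient into one of two continuous slopes. *)
Lemma divide_by_cos (d : R -> R) (x : R) : smooth d -> 0 < x < 1 -> d x = 0 ->
  exists h, cont01 h /\
    forall y, 0 <= y <= 1 -> d y = h y * (cos (PI * y) - cos (PI * x)).
Proof.
  intros Hd Hx H0.
  set (c := fun y => cos (PI * y)).
  assert (Hc : is_derive c x (- (PI * sin (PI * x)))) by (unfold c; auto_derive; auto; ring).
  set (den := slope c x (- (PI * sin (PI * x)))).
  assert (Hden : forall y, 0 <= y <= 1 -> den y <> 0).
  { intros y Hy. unfold den, slope. destruct (Req_EM_T y x).
    - apply Ropp_neq_0_compat, Rmult_integral_contrapositive_currified.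
      + apply Rgt_not_eq, PI_RGT_0.
      + apply Rgt_not_eq, sin_gt_0; pose proof PI_RGT_0; nra.
    - apply Rmult_integral_contrapositive_currified.
      + apply cos_PI_inj; lra.
      + apply Rinv_neq_0_compat. lra. }
  exists (fun y => slope d x (Derive d x) y * / den y). split.
  - intros y Hy. apply (continuous_mult (K := R_AbsRing)).
    + apply slope_continuous; [intros; now apply smooth_continuous|now apply smooth_is_derive].
    + apply (continuous_comp den Rinv).
      * apply slope_continuous; auto. intros z. unfold c.
        apply (ex_derive_continuous (V := R_NormedModule)). auto_derive; auto.
      * apply continuous_Rinv. auto.
  - intros y Hy. specialize (Hden y Hy). unfold den, slope in *.
    destruct (Req_EM_T y x) as [->|]; [rewrite H0; ring|].
    fold (c y). fold (c x). rewrite H0. field_simplify_eq; [ring|].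
    pose proof (cos_PI_inj x y ltac:(lra) Hy n) as Hn. fold (c y) in Hn. fold (c x) in Hn.
    split; [lra|auto].
Qed.

Lemma phi_rec (k : nat) (y : R) :
  phi (S (S k)) y + phi k y = 2 * cos (PI * y) * phi (S k) y.
Proof.
  unfold phi. rewrite !S_INR.
  replace ((INR k + 1 + 1) * PI * y) with ((INR k + 1) * PI * y + PI * y) by ring.
  replace (INR k * PI * y) with ((INR k + 1) * PI * y - PI * y) by ring.
  rewrite sin_plus, sin_minus. ring.
Qed.

Lemma phi_O (y : R) : phi 0 y = 0.
Proof. unfold phi. simpl. rewrite !Rmult_0_l, sin_0. ring. Qed.

Lemma phi_at_0 (j : nat) : phi j 0 = 0.
Proof. unfold phi. rewrite Rmult_0_r, sin_0. ring. Qed.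

Lemma phi_at_1 (j : nat) : phi j 1 = 0.
Proof. unfold phi. rewrite Rmult_1_r, sin_INR_PI. ring. Qed.

Lemma phi_bound (j : nat) (x : R) : Rabs (phi j x) <= sqrt 2.
Proof.
  unfold phi. rewrite Rabs_mult, (Rabs_pos_eq (sqrt 2)) by apply sqrt_pos.
  rewrite <- (Rmult_1_r (sqrt 2)) at 2. apply Rmult_le_compat_l; [apply sqrt_pos|].
  apply Rabs_le, SIN_bound.
Qed.

(* Christoffel-Darboux: when [d y = h y * (cos (PI * y) - cos (PI * x))] the partial sums
   of the sine series of [d] at [x] telescope to two coefficients of [h]. *)
Lemma partial_sum_telescopes (d h : R -> R) (x : R) (N : nat) : cont01 h ->
  (forall y, 0 <= y <= 1 -> d y = h y * (cos (PI * y) - cos (PI * x))) ->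
  sum_n (fun k => ip d (phi (S k)) * phi (S k) x) N
  = / 2 * (phi (S N) x * ip h (phi (S (S N))) - phi (S (S N)) x * ip h (phi (S N))) :> R.
Proof.
  intros Hh Hd.
  (* By [phi_rec], multiplication by [cos (PI * y)] averages the two neighbouring modes, so each
     coefficient of [d] involves three consecutive coefficients of [h]. *)
  assert (C : forall k, ip d (phi (S k))
    = / 2 * (ip h (phi (S (S k))) + ip h (phi k)) - cos (PI * x) * ip h (phi (S k))).
  { intros k.
    transitivity (ip h (fun y => 1 * (/ 2 * phi (S (S k)) y + / 2 * phi k y)
                                 + (- cos (PI * x)) * phi (S k) y)).
    - apply ip_ext. intros y Hy. rewrite Hd by auto.
      replace (/ 2 * phi (S (S k)) y + / 2 * phi k y)
        with (cos (PI * y) * phi (S k) y) by (pose proof (phi_rec k y); lra).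
      ring.
    - rewrite ip_lin_r, ip_lin_r by auto using cont01_lin, cont01_phi. ring. }
  assert (Z : ip h (phi 0) = 0).
  { transitivity (ip h (fun y => 0 * phi 0 y + 0 * phi 0 y)).
    - apply ip_ext. intros y _. rewrite phi_O. ring.
    - rewrite ip_lin_r by auto using cont01_phi. ring. }
  induction N as [|N IH].
  - rewrite sum_n_0, C, Z. pose proof (phi_rec 0 x) as E. rewrite phi_O in E.
    replace (phi 2 x) with (2 * cos (PI * x) * phi 1 x) by lra. field.
  - rewrite sum_n_S, IH, C.
    replace (phi (S (S (S N))) x)
      with (2 * cos (PI * x) * phi (S (S N)) x - phi (S N) x)
      by (pose proof (phi_rec (S N) x); lra).
    field.
Qed.

(** Subtracting a multiple of [phi 1], which does not vanish at [x] and whose sine series has a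
    single term, reduces to a function [d] with [d x = 0]. Its partial sums telescope to two
    coefficients of a continuous function, which tend to [0] by Riemann-Lebesgue. *)
Lemma sine_series_pointwise (g : R -> R) (x : R) : smooth g -> 0 < x < 1 ->
  is_series (fun k => ip g (phi (S k)) * phi (S k) x) (g x).
Proof.
  intros Hg Hx.
  assert (Hp : phi 1 x <> 0).
  { unfold phi. apply Rmult_integral_contrapositive_currified.
    - apply Rgt_not_eq, sqrt_lt_R0. lra.
    - simpl. apply Rgt_not_eq, sin_gt_0; pose proof PI_RGT_0; nra. }
  set (ka := g x / phi 1 x).
  set (d := fun y => 1 * g y + (- ka) * phi 1 y).
  assert (Sd : smooth d) by (apply smooth_plus; apply smooth_scal; auto using smooth_phi).
  assert (D0 : d x = 0) by (unfold d, ka; field; auto).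
  destruct (divide_by_cos d x Sd Hx D0) as [h [Hh Hd]].
  assert (E : forall N, sum_n (fun k => ip g (phi (S k)) * phi (S k) x) N
     = g x + / 2 * (phi (S N) x * ip h (phi (S (S N))) - phi (S (S N)) x * ip h (phi (S N))) :> R).
  { intros N. rewrite <- (partial_sum_telescopes d h x N Hh Hd).
    assert (Cd : forall k, ip d (phi (S k)) = ip g (phi (S k)) - ka * ip (phi 1) (phi (S k))).
    { intros k. unfold d. rewrite ip_lin_l by auto using cont01_phi, cont01_smooth. ring. }
    replace (g x) with (ka * phi 1 x) by (unfold ka; field; auto).
    induction N as [|N IH].
    - rewrite !sum_n_0, Cd, ip_phi_S. destruct (Nat.eq_dec 0 0); [ring|lia].
    - rewrite !sum_n_S, IH, Cd, ip_phi_S. destruct (Nat.eq_dec 0 (S N)); [lia|].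
      ring. }
  assert (L := riemann_lebesgue h Hh).
  assert (Lm : forall u v, is_lim_seq u 0 -> is_lim_seq (fun N => phi (v N) x * u N) 0).
  { intros u v Hu. apply is_lim_seq_abs_0.
    apply (is_lim_seq_le_le (fun _ => 0) _ (fun N => sqrt 2 * Rabs (u N))).
    - intros n. split; [apply Rabs_pos|]. rewrite Rabs_mult.
      apply Rmult_le_compat_r; [apply Rabs_pos|apply phi_bound].
    - apply is_lim_seq_const.
    - replace (Finite 0) with (Finite (sqrt 2 * 0)) by (f_equal; ring). apply (is_lim_seq_scal_l _ (sqrt 2) 0).
      now apply (proj1 (is_lim_seq_abs_0 u)). }
  change (is_lim_seq (sum_n (fun k => ip g (phi (S k)) * phi (S k) x)) (g x)).
  apply (is_lim_seq_ext (fun N => g x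
     + / 2 * (phi (S N) x * ip h (phi (S (S N))) - phi (S (S N)) x * ip h (phi (S N))))).
  { intros N. symmetry. apply E. }
  replace (Finite (g x)) with (Finite (g x + 0)) by (f_equal; ring).
  apply is_lim_seq_plus'; [apply is_lim_seq_const|].
  replace (Finite 0) with (Finite (/ 2 * (0 - 0))) by (f_equal; ring).
  apply (is_lim_seq_scal_l _ (/ 2) (0 - 0)).
  apply is_lim_seq_minus'; apply Lm; [|exact L].
  now apply (is_lim_seq_incr_1 (fun k => ip h (phi (S k)))).
Qed.

(** * Shifted second-order operators as multipliers of sine coefficients *)

Definition flat (g : R -> R) : Prop := smooth g /\ off g 0 /\ off g 1.

(* [-d^2/dx^2 - a], acting on the [j]-th sine coefficient as [lam j - a] *)
Definition shifted_op (a : R) (g : R -> R) : R -> R :=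
  fun x => (-1) * Derive (Derive g) x + (- a) * g x.

Fixpoint op_chain (L : list R) (g : R -> R) : R -> R :=
  match L with
  | nil => g
  | cons a L' => op_chain L' (shifted_op a g)
  end.

(** The monic polynomial with root list [L], evaluated at [z]: its value at [lam j] is the
    multiplier of [op_chain L] on the [j]-th coefficient. *)
Definition eval_roots (L : list R) (z : R) : R := fold_right (fun a r => (z - a) * r) 1 L.

Lemma smooth_shifted_op (a : R) (g : R -> R) : smooth g -> smooth (shifted_op a g).
Proof. intros H. apply smooth_plus; apply smooth_scal; auto. now do 2 apply smooth_Derive. Qed.

Lemma off_shifted_op (a : R) (g : R -> R) (x : R) : off g x -> off (shifted_op a g) x.
Proof. intros H. apply (off_lin (-1) (- a)); auto. now do 2 apply off_Derive. Qed.

Lemma smooth_op_chain (L : list R) : forall g, smooth g -> smooth (op_chain L g).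
Proof. induction L as [|a L IH]; simpl; auto using smooth_shifted_op. Qed.

Lemma off_op_chain (L : list R) (x : R) : forall g, off g x -> off (op_chain L g) x.
Proof. induction L as [|a L IH]; simpl; auto using off_shifted_op. Qed.

(** This stability is why [flat] demands vanishing near the endpoints: boundary terms then stay
    absent at every operator of a chain. *)
Lemma flat_shifted_op (a : R) (g : R -> R) : flat g -> flat (shifted_op a g).
Proof. intros (H & H0 & H1). repeat split; auto using smooth_shifted_op, off_shifted_op. Qed.

Lemma flat_op_chain (L : list R) (g : R -> R) : flat g -> flat (op_chain L g).
Proof. intros (H & H0 & H1). repeat split; auto using smooth_op_chain, off_op_chain. Qed.

Lemma Derive_lin (a b : R) (f g : R -> R) : smooth f -> smooth g ->
  Derive (fun x => a * f x + b * g x) = (fun x => a * Derive f x + b * Derive g x).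
Proof.
  intros Hf Hg. apply functional_extensionality; intros x.
  rewrite Derive_plus by (apply ex_derive_scal; now apply smooth_ex_derive).
  now rewrite !Derive_scal.
Qed.

Lemma shifted_op_lin (s a b : R) (f g : R -> R) : smooth f -> smooth g ->
  shifted_op s (fun x => a * f x + b * g x)
  = (fun x => a * shifted_op s f x + b * shifted_op s g x).
Proof.
  intros Hf Hg. unfold shifted_op. rewrite !Derive_lin by auto using smooth_Derive.
  apply functional_extensionality; intros x. ring.
Qed.

Lemma op_chain_lin (L : list R) (a b : R) : forall f g, smooth f -> smooth g ->
  op_chain L (fun x => a * f x + b * g x)
  = (fun x => a * op_chain L f x + b * op_chain L g x).
Proof.
  induction L as [|s L IH]; simpl; auto. intros f g Hf Hg.
  rewrite shifted_op_lin by auto. apply IH; now apply smooth_shifted_op.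
Qed.

Lemma Derive2_phi (j : nat) : Derive (Derive (phi j)) = (fun x => - lam j * phi j x).
Proof.
  rewrite phi_trig, !Derive_trig. apply functional_extensionality; intros x.
  unfold lam. ring.
Qed.

(** Green's identity: [g'' phi_j + lam_j g phi_j] is the derivative of [g' phi_j - g phi_j'], which
    is zero at both endpoints. *)
Lemma ip_Derive2 (g : R -> R) (j : nat) : smooth g -> g 0 = 0 -> g 1 = 0 ->
  ip (Derive (Derive g)) (phi j) = - lam j * ip g (phi j).
Proof.
  intros H H0 H1.
  assert (Sg := smooth_Derive _ H). assert (Sp := smooth_phi j).
  assert (Sp' := smooth_Derive _ Sp).
  assert (E : RInt (fun x => 1 * (Derive (Derive g) x * phi j x) + lam j * (g x * phi j x)) 0 1
     = 0 :> R).
  { rewrite (RInt_Derive_eq (fun x => Derive g x * phi j x - g x * Derive (phi j) x)).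
    - rewrite phi_at_0, phi_at_1, H0, H1. ring.
    - intros x. evar_last.
      + apply (is_derive_minus (V := R_NormedModule)).
        * apply (is_derive_mult (K := R_AbsRing)); [apply smooth_is_derive; auto..|].
          intros; apply Rmult_comm.
        * apply (is_derive_mult (K := R_AbsRing)); [apply smooth_is_derive; auto..|].
          intros; apply Rmult_comm.
      + rewrite Derive2_phi. unfold minus, plus, opp, mult; simpl. ring.
    - intros x. apply smooth_continuous. apply smooth_plus; apply smooth_scal; apply smooth_mult;
      auto. now apply smooth_Derive. }
  rewrite RInt_lin in E.
  - unfold ip. lra.
  - apply ex_RInt_cont01, cont01_mult; apply cont01_smooth; auto using smooth_Derive.
  - apply ex_RInt_cont01, cont01_mult; apply cont01_smooth; auto.
Qed.

Lemma ip_shifted_op (a : R) (g : R -> R) (j : nat) : flat g ->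
  ip (shifted_op a g) (phi j) = (lam j - a) * ip g (phi j).
Proof.
  intros (H & H0 & H1). unfold shifted_op.
  rewrite ip_lin_l by (apply cont01_smooth; auto using smooth_Derive, smooth_phi).
  rewrite ip_Derive2 by (auto; now apply off_eq). ring.
Qed.

Lemma ip_op_chain (L : list R) (j : nat) : forall g, flat g ->
  ip (op_chain L g) (phi j) = eval_roots L (lam j) * ip g (phi j).
Proof.
  induction L as [|a L IH]; simpl; intros g Hg; [ring|].
  rewrite IH, ip_shifted_op by auto using flat_shifted_op. ring.
Qed.

(** * Decay of sine coefficients and Parseval's identity *)

Lemma lam_S_ge (k : nat) : INR (S k) ^ 2 <= lam (S k).
Proof.
  unfold lam. rewrite Rpow_mult_distr.
  assert (1 <= PI) by (pose proof PI2_1; lra).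
  pose proof (pow2_ge_0 (INR (S k))). assert (1 <= PI ^ 2) by (apply pow_R1_Rle; auto). nra.
Qed.

Lemma ex_series_inv_sqr : ex_series (fun k => / INR (S k) ^ 2).
Proof.
  apply (ex_series_nonneg_bounded _ 2).
  - intros n. apply Rlt_le, Rinv_0_lt_compat, pow_lt, lt_0_INR. lia.
  (* The sharper bound makes the induction go through, by [1/(x+1)^2 <= 1/x - 1/(x+1)]. *)
  - intros n. assert (sum_n (fun k => / INR (S k) ^ 2) n <= 2 - / INR (S n)).
    { induction n as [|n IH]; [rewrite sum_n_0; simpl; lra|].
      rewrite sum_n_S. rewrite (S_INR (S n)).
      assert (P : 0 < INR (S n)) by (apply lt_0_INR; lia). set (x := INR (S n)) in *.
      assert (/ (x + 1) ^ 2 <= / x - / (x + 1)).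
      { replace (/ x - / (x + 1)) with (/ (x * (x + 1))) by (field; lra).
        apply Rinv_le_contravar; nra. }
      lra. }
    assert (0 < / INR (S n)) by (apply Rinv_0_lt_compat, lt_0_INR; lia). lra.
Qed.

(** One operator with shift [0] multiplies the coefficients by [lam j >= j ^ 2], and the result is
    still bounded. *)
Lemma sine_coef_decay (g : R -> R) : flat g ->
  exists C, forall k, Rabs (ip g (phi (S k))) <= C * / INR (S k) ^ 2.
Proof.
  intros Hg. destruct (coef_bounded (shifted_op 0 g)) as [B [HB Hb]].
  { apply cont01_smooth, smooth_shifted_op, Hg. }
  exists B. intros k. specialize (Hb k). rewrite ip_shifted_op, Rminus_0_r, Rabs_mult in Hb by auto.
  pose proof (lam_S_ge k) as Hl.
  assert (P : 0 < INR (S k) ^ 2) by (apply pow_lt, lt_0_INR; lia).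
  rewrite (Rabs_pos_eq (lam (S k))) in Hb by lra.
  apply (Rmult_le_reg_l (INR (S k) ^ 2)); auto.
  replace (INR (S k) ^ 2 * (B * / INR (S k) ^ 2)) with B by (field; apply not_0_INR; lia).
  eapply Rle_trans; [|exact Hb]. apply Rmult_le_compat_r; auto using Rabs_pos.
Qed.

(** Quantitative Weierstrass test: with [a] independent of a parameter in [b], the right-hand side
    bounds the remainder uniformly. *)
Lemma series_tail_bound (a b : nat -> R) (s l : R) (N : nat) :
  (forall k, Rabs (b k) <= a k) -> is_series a s -> is_series b l ->
  Rabs (l - sum_n b N) <= s - sum_n a N.
Proof.
  intros H Ha Hb.
  assert (T : forall m, Rabs (sum_n b (m + N) - sum_n b N) <= sum_n a (m + N) - sum_n a N).
  { induction m as [|m IH].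
    - change (0 + N)%nat with N. rewrite !Rminus_diag, Rabs_R0. apply Rle_refl.
    - change (S m + N)%nat with (S (m + N)). rewrite !sum_n_S. specialize (H (S (m + N))).
      replace (sum_n b (m + N) + b (S (m + N)) - sum_n b N)
        with ((sum_n b (m + N) - sum_n b N) + b (S (m + N))) by ring.
      eapply Rle_trans; [apply Rabs_triang|]. lra. }
  refine (is_lim_seq_le _ _ (Finite (Rabs (l - sum_n b N))) (Finite (s - sum_n a N)) T _ _).
  - apply (is_lim_seq_abs _ (l - sum_n b N)).
    apply is_lim_seq_minus'; [|apply is_lim_seq_const].
    now apply (is_lim_seq_incr_n (sum_n b) N l).
  - apply is_lim_seq_minus'; [|apply is_lim_seq_const].
    now apply (is_lim_seq_incr_n (sum_n a) N s).
Qed.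

Lemma cont01_bounded (f : R -> R) : cont01 f ->
  exists F, 0 <= F /\ forall x, 0 <= x <= 1 -> Rabs (f x) <= F.
Proof.
  intros H. destruct (continuity_ab_maj (fun x => Rabs (f x)) 0 1 Rle_0_1) as [m [Hm _]].
  - intros c Hc. apply continuity_pt_filterlim.
    apply (continuous_comp f Rabs); [now apply H|apply continuous_Rabs].
  - exists (Rabs (f m)). split; [apply Rabs_pos|]. exact Hm.
Qed.

Lemma cont01_partial_sum (c : nat -> R) (N : nat) :
  cont01 (fun x => sum_n (fun k => c k * phi (S k) x) N).
Proof.
  intros x Hx. apply (continuous_ext (fun x => sum_n (fun k => c k * phi (S k) x) N)); [auto|].
  induction N as [|N IH].
  - apply (continuous_ext (fun x => c O * phi 1 x)); [intros; now rewrite sum_n_0|].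
    apply (continuous_scal_r (V := R_NormedModule)). now apply cont01_phi.
  - apply (continuous_ext (fun x => sum_n (fun k => c k * phi (S k) x) N
                                    + c (S N) * phi (S (S N)) x)); [intros; now rewrite sum_n_S|].
    apply (continuous_plus (V := R_NormedModule)); auto.
    apply (continuous_scal_r (V := R_NormedModule)). now apply cont01_phi.
Qed.

Lemma ip_partial_sum (f : R -> R) (c : nat -> R) (N : nat) : cont01 f ->
  ip f (fun x => sum_n (fun k => c k * phi (S k) x) N)
  = sum_n (fun k => ip f (phi (S k)) * c k) N :> R.
Proof.
  intros Hf. induction N as [|N IH].
  - rewrite sum_n_0. transitivity (ip f (fun x => c O * phi 1 x + 0 * phi 1 x)).
    + apply ip_ext. intros x _. rewrite sum_n_0. ring.
    + rewrite ip_lin_r by auto using cont01_phi. ring.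
  - rewrite sum_n_S, <- IH.
    transitivity (ip f (fun x => 1 * sum_n (fun k => c k * phi (S k) x) N
                                 + c (S N) * phi (S (S N)) x)).
    + apply ip_ext. intros x _. rewrite sum_n_S. ring.
    + rewrite ip_lin_r by auto using cont01_phi, cont01_partial_sum. ring.
Qed.

Lemma is_series_zero (a : nat -> R) : (forall n, a n = 0) -> is_series a 0.
Proof.
  intros H. change (is_lim_seq (sum_n a) 0).
  apply (is_lim_seq_ext (fun _ => 0)); [|apply is_lim_seq_const].
  intros n. symmetry. induction n as [|n IH]; rewrite ?sum_n_0, ?sum_n_S, ?IH, H; [|rewrite Rplus_0_r]; auto.
Qed.

(** The quadratic decay of the coefficients of [g] makes its sine series converge uniformly on
    [[0, 1]], so it can be integrated term by term against the bounded function [f]. *)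
Lemma sine_parseval (f g : R -> R) : cont01 f -> flat g ->
  is_series (fun k => ip f (phi (S k)) * ip g (phi (S k))) (ip f g).
Proof.
  intros Hf Hg. destruct (sine_coef_decay g Hg) as [C HC].
  destruct (cont01_bounded f Hf) as [F [HF Hb]].
  set (a := fun k => (sqrt 2 * C) * / INR (S k) ^ 2).
  destruct (ex_series_scal_l (K := R_AbsRing) (sqrt 2 * C) _ ex_series_inv_sqr) as [s Hs].
  change (is_series a s) in Hs.
  set (b := fun x k => ip g (phi (S k)) * phi (S k) x).
  assert (Hab : forall x k, Rabs (b x k) <= a k).
  { intros x k. unfold a, b. rewrite Rabs_mult, Rmult_comm, Rmult_assoc.
    apply Rmult_le_compat; auto using Rabs_pos, phi_bound. }
  assert (Hgx : forall x, 0 <= x <= 1 -> is_series (b x) (g x)).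
  (* The pointwise theorem covers only the open interval; at the endpoints [g] and all modes
     vanish. *)
  { intros x Hx. destruct (Req_dec x 0) as [->|N0]; [|destruct (Req_dec x 1) as [->|N1]].
    - rewrite (off_eq g 0) by apply Hg. apply is_series_zero.
      intros n. unfold b. rewrite phi_at_0. ring.
    - rewrite (off_eq g 1) by apply Hg. apply is_series_zero.
      intros n. unfold b. rewrite phi_at_1. ring.
    - apply sine_series_pointwise; [apply Hg|lra]. }
  assert (Cg : cont01 g) by apply cont01_smooth, Hg.
  assert (E : forall N, Rabs (sum_n (fun k => ip f (phi (S k)) * ip g (phi (S k))) N - ip f g)
              <= F * (s - sum_n a N)).
  { intros N. rewrite <- (ip_partial_sum f (fun k => ip g (phi (S k)))) by auto.
    pose proof (cont01_partial_sum (fun k => ip g (phi (S k))) N) as Cs.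
    replace (ip f (fun x => sum_n (fun k => ip g (phi (S k)) * phi (S k) x) N) - ip f g)
      with (ip f (fun x => 1 * sum_n (fun k => ip g (phi (S k)) * phi (S k) x) N + (-1) * g x))
      by (rewrite ip_lin_r by auto; ring).
    unfold ip at 1.
    replace (F * (s - sum_n a N)) with ((1 - 0) * (F * (s - sum_n a N))) by ring.
    apply abs_RInt_le_const; [lra| |].
    - apply ex_RInt_cont01, cont01_mult; auto. now apply cont01_lin.
    - intros x Hx. rewrite Rabs_mult. apply Rmult_le_compat; auto using Rabs_pos.
      replace (1 * sum_n (fun k => ip g (phi (S k)) * phi (S k) x) N + -1 * g x)
        with (- (g x - sum_n (b x) N)) by (unfold b; ring).
      rewrite Rabs_Ropp. apply series_tail_bound; auto. }
  set (S := sum_n (fun k => ip f (phi (S k)) * ip g (phi (S k)))) in *.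
  change (is_lim_seq S (ip f g)).
  apply (is_lim_seq_ext (fun N => (S N - ip f g) + ip f g)); [intros; ring|].
  replace (Finite (ip f g)) with (Finite (0 + ip f g)) by (f_equal; ring).
  apply is_lim_seq_plus'; [|apply is_lim_seq_const].
  apply is_lim_seq_abs_0.
  apply (is_lim_seq_le_le (fun _ => 0) _ (fun N => F * (s - sum_n a N))).
  - intros N. split; [apply Rabs_pos|apply E].
  - apply is_lim_seq_const.
  - replace (Finite 0) with (Finite (F * (s - s))) by (f_equal; ring).
    apply (is_lim_seq_scal_l _ F (s - s)).
    apply is_lim_seq_minus'; [apply is_lim_seq_const|exact Hs].
Qed.

(** * The quadratic forms as integrals *)

(** Up to sign, the polynomial in [lam j] that multiplies [cc mu K j] in [A mu K p] has these
    roots. *)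
Definition roots (K p : nat) : list R :=
  (lam 1 + lam K) / 2 :: repeat (lam K) (p - 1) ++ repeat (lam 1) (p - 1).

Lemma eval_roots_repeat (a z : R) (m : nat) (L : list R) :
  eval_roots (repeat a m ++ L) z = (z - a) ^ m * eval_roots L z.
Proof. induction m as [|m IH]; simpl; [ring|]. rewrite IH. ring. Qed.

Lemma eval_roots_roots (K p : nat) (z : R) : eval_roots (roots K p) z
  = (z - (lam 1 + lam K) / 2) * (z - lam K) ^ (p - 1) * (z - lam 1) ^ (p - 1).
Proof.
  unfold roots. simpl. rewrite eval_roots_repeat.
  rewrite <- (app_nil_r (repeat (lam 1) (p - 1))), eval_roots_repeat. simpl. ring.
Qed.

Lemma length_roots (K p : nat) : (1 <= p)%nat -> length (roots K p) = (2 * p - 1)%nat.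
Proof. intros H. unfold roots. simpl. rewrite length_app, !repeat_length. lia. Qed.

Lemma flat_mult (f g : R -> R) : flat f -> smooth g -> flat (fun x => f x * g x).
Proof. intros (H & H0 & H1) Hg. repeat split; auto using smooth_mult, off_mult_l. Qed.

Lemma A_eq_ip (mu : R -> R) (K p : nat) : flat mu ->
  A mu K p = ip (op_chain (roots K p) (fun x => mu x * phi 1 x)) (fun x => mu x * phi K x).
Proof.
  intros Hmu. set (u := fun x => mu x * phi 1 x). set (v := fun x => mu x * phi K x).
  assert (Hu : flat u) by (apply flat_mult; auto using smooth_phi).
  assert (Hv : flat v) by (apply flat_mult; auto using smooth_phi).
  rewrite <- (is_series_unique _ _ (sine_parseval (op_chain (roots K p) u) v
     (cont01_smooth _ (proj1 (flat_op_chain _ _ Hu))) Hv)).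
  unfold A. rewrite <- Series_scal_l. apply Series_ext. intros k. cbv zeta.
  rewrite ip_op_chain, eval_roots_roots by auto. unfold cc. fold u v.
  (* Reversing this difference produces a second [(-1) ^ (p - 1)], which cancels the one in the
     definition of [A]. *)
  replace ((lam K - lam (S k)) ^ (p - 1)) with ((-1) ^ (p - 1) * (lam (S k) - lam K) ^ (p - 1))
    by (rewrite <- Rpow_mult_distr; f_equal; ring).
  transitivity (((-1) ^ (p - 1) * (-1) ^ (p - 1)) * ((lam (S k) - (lam 1 + lam K) / 2)
    * (lam (S k) - lam K) ^ (p - 1) * (lam (S k) - lam 1) ^ (p - 1)
    * ip u (phi (S k)) * ip v (phi (S k)))); [ring|].
  rewrite <- Rpow_mult_distr. replace (-1 * -1) with 1 by ring. rewrite pow1. ring.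
Qed.

(** Since [j ^ (4 n) <= lam_j ^ (2 n)], the weight is absorbed by [2 n] operators with shift [0]
    acting on [mu phi_1]. The product of the two coefficients is then below the sum of their
    squares, and Bessel applies to each. *)
Lemma ex_series_weighted_cc (mu : R -> R) (K n : nat) : flat mu ->
  ex_series (fun k : nat => INR (S k) ^ (4 * n) * Rabs (cc mu K (S k))).
Proof.
  intros Hmu. set (u := fun x => mu x * phi 1 x). set (v := fun x => mu x * phi K x).
  assert (Hu : flat u) by (apply flat_mult; auto using smooth_phi).
  assert (Hv : flat v) by (apply flat_mult; auto using smooth_phi).
  set (w := op_chain (repeat 0 (2 * n)) u).
  assert (Hw : cont01 w) by apply cont01_smooth, flat_op_chain, Hu.
  assert (Cv : cont01 v) by apply cont01_smooth, Hv.
  apply (ex_series_le (K := R_AbsRing) (V := R_CompleteNormedModule) _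
    (fun k => ip w (phi (S k)) ^ 2 + ip v (phi (S k)) ^ 2)).
  - intros k. change (Rabs (INR (S k) ^ (4 * n) * Rabs (cc mu K (S k)))
      <= ip w (phi (S k)) ^ 2 + ip v (phi (S k)) ^ 2).
    unfold cc. fold u v. rewrite !Rabs_mult, !Rabs_Rabsolu.
    assert (E : Rabs (INR (S k) ^ (4 * n)) * Rabs (ip u (phi (S k))) <= Rabs (ip w (phi (S k)))).
    { unfold w. rewrite ip_op_chain by auto.
      rewrite <- (app_nil_r (repeat 0 (2 * n))), eval_roots_repeat. simpl eval_roots.
      rewrite Rmult_1_r, Rminus_0_r, Rabs_mult.
      apply Rmult_le_compat_r; [apply Rabs_pos|].
      replace (4 * n)%nat with (2 * (2 * n))%nat by lia. rewrite pow_mult.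
      pose proof (lam_S_ge k). pose proof (pow2_ge_0 (INR (S k))).
      rewrite !Rabs_pos_eq by (apply pow_le; lra). apply pow_incr. lra. }
    rewrite <- Rmult_assoc. rewrite <- (pow2_abs (ip w (phi (S k)))), <- (pow2_abs (ip v (phi (S k)))).
    pose proof (Rabs_pos (ip v (phi (S k)))) as P.
    pose proof (Rmult_le_compat_r _ _ _ P E).
    pose proof (pow2_ge_0 (Rabs (ip w (phi (S k))) - Rabs (ip v (phi (S k))))).
    pose proof (pow2_ge_0 (Rabs (ip w (phi (S k))))).
    pose proof (pow2_ge_0 (Rabs (ip v (phi (S k))))). nra.
  - apply (ex_series_plus (V := R_NormedModule)); now apply ex_series_bessel.
Qed.

(** * Concentrating bumps *)

(** A plane containing [phi 1] and closed under differentiation, so that operators map products of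
    rescaled profiles and such functions to sums of products of the same shape. *)
Definition trig (a b x : R) : R := a * sin (PI * x) + b * cos (PI * x).

Definition bounded_smooth (f : R -> R) : Prop :=
  smooth f /\ forall k, exists C, 0 <= C /\ forall x, Rabs (Derive_n f k x) <= C.

Lemma bounded_smooth_Derive (f : R -> R) : bounded_smooth f -> bounded_smooth (Derive f).
Proof.
  intros [H B]. split; [now apply smooth_Derive|]. intros k. rewrite Derive_n_Derive. apply B.
Qed.

Lemma smooth_bump_trig (f : R -> R) (s x0 a b : R) : smooth f ->
  smooth (fun y => f (s * (y - x0)) * trig a b y).
Proof. intros H. apply smooth_mult; [now apply smooth_affine|apply smooth_trig]. Qed.

Lemma Derive_bump_trig (f : R -> R) (s x0 a b : R) : smooth f ->
  Derive (fun y => f (s * (y - x0)) * trig a b y)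
  = (fun y => s * (Derive f (s * (y - x0)) * trig a b y)
              + 1 * (f (s * (y - x0)) * trig (- (PI * b)) (PI * a) y)).
Proof.
  intros H. apply functional_extensionality; intros x.
  assert (Ht : smooth (trig a b)) by apply smooth_trig.
  rewrite Derive_mult.
  - rewrite Derive_affine by auto. unfold trig at 2. rewrite Derive_trig. unfold trig. ring.
  - apply smooth_ex_derive. now apply smooth_affine.
  - now apply smooth_ex_derive.
Qed.

Lemma shifted_op_bump_trig (r : R) (f : R -> R) (s x0 a b : R) : smooth f ->
  shifted_op r (fun y => f (s * (y - x0)) * trig a b y)
  = (fun y => (- s ^ 2) * (Derive (Derive f) (s * (y - x0)) * trig a b y)
      + 1 * ((-2 * s) * (Derive f (s * (y - x0)) * trig (- (PI * b)) (PI * a) y)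
             + 1 * (f (s * (y - x0)) * trig ((PI ^ 2 - r) * a) ((PI ^ 2 - r) * b) y))).
Proof.
  intros H. assert (H' := smooth_Derive _ H). unfold shifted_op.
  rewrite Derive_bump_trig, Derive_lin, !Derive_bump_trig by auto using smooth_bump_trig.
  apply functional_extensionality; intros x. unfold trig. ring.
Qed.

Lemma trig_bound (a b x : R) : Rabs (trig a b x) <= Rabs a + Rabs b.
Proof.
  unfold trig. eapply Rle_trans; [apply Rabs_triang|]. rewrite !Rabs_mult.
  pose proof (Rabs_le _ _ (SIN_bound (PI * x))). pose proof (Rabs_le _ _ (COS_bound (PI * x))).
  apply Rplus_le_compat; rewrite <- Rmult_1_r; apply Rmult_le_compat_l; auto using Rabs_pos.
Qed.

(** Each operator gains its full factor [- s ^ 2] only when both derivatives fall on the profile;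
    every other term loses at least one power of [s]. The prefactor [s] on the left expresses this
    relative error of order [1 / s]. The constant is uniform in [x0] and [x]. *)
Lemma op_chain_bump (L : list R) : forall f a b, bounded_smooth f ->
  exists C, 0 <= C /\ forall s x0 x, 1 <= s ->
    s * Rabs (op_chain L (fun y => f (s * (y - x0)) * trig a b y) x
       - (-1) ^ length L * s ^ (2 * length L)
         * (Derive_n f (2 * length L) (s * (x - x0)) * trig a b x))
    <= C * s ^ (2 * length L).
Proof.
  induction L as [|r L IH]; intros f a b Hf.
  - exists 0. split; [lra|]. intros s x0 x Hs. simpl.
    rewrite !Rmult_1_l, Rminus_diag, Rabs_R0. lra.
  - assert (Hf' := bounded_smooth_Derive _ Hf). assert (Hf'' := bounded_smooth_Derive _ Hf').
    (* For the lower-order terms the size alone matters: the expansion with its bounded main term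
       gives a crude bound by [s ^ (2 * length L)]. *)
    assert (IHb : forall g c d, bounded_smooth g -> exists C, 0 <= C /\ forall s x0 x, 1 <= s ->
      Rabs (op_chain L (fun y => g (s * (y - x0)) * trig c d y) x) <= C * s ^ (2 * length L)).
    { intros g c d Hg. destruct (IH g c d Hg) as [C [HC H]].
      destruct (proj2 Hg (2 * length L)%nat) as [D [HD HDb]].
      exists (C + D * (Rabs c + Rabs d)). split.
      { pose proof (Rabs_pos c). pose proof (Rabs_pos d). nra. }
      intros s x0 x Hs. specialize (H s x0 x Hs).
      set (X := op_chain L _ x) in *. set (m := length L) in *.
      set (Y := Derive_n g (2 * m) (s * (x - x0)) * trig c d x) in *.
      assert (P : 0 < s ^ (2 * m)) by (apply pow_lt; lra).
      assert (HY : Rabs Y <= D * (Rabs c + Rabs d)).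
      { unfold Y. rewrite Rabs_mult. apply Rmult_le_compat; auto using Rabs_pos, trig_bound. }
      replace X with ((X - (-1) ^ m * s ^ (2 * m) * Y) + (-1) ^ m * s ^ (2 * m) * Y) by ring.
      eapply Rle_trans; [apply Rabs_triang|].
      rewrite (Rabs_mult ((-1) ^ m * s ^ (2 * m))), (Rabs_mult ((-1) ^ m)), pow_1_abs,
        (Rabs_pos_eq (s ^ (2 * m))), Rmult_1_l by lra.
      pose proof (Rabs_pos (X - (-1) ^ m * s ^ (2 * m) * Y)). nra. }
    destruct (IH _ a b Hf'') as [C1 [HC1 H1]].
    destruct (IHb _ (- (PI * b)) (PI * a) Hf') as [C2 [HC2 H2]].
    destruct (IHb _ ((PI ^ 2 - r) * a) ((PI ^ 2 - r) * b) Hf) as [C3 [HC3 H3]].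
    exists (C1 + 2 * C2 + C3). split; [lra|]. intros s x0 x Hs.
    specialize (H1 s x0 x Hs). specialize (H2 s x0 x Hs). specialize (H3 s x0 x Hs).
    simpl op_chain. simpl length. set (m := length L) in *.
    destruct Hf as [Sf _], Hf' as [Sf' _], Hf'' as [Sf'' _].
    rewrite shifted_op_bump_trig, op_chain_lin, op_chain_lin
      by auto using smooth_bump_trig, smooth_plus, smooth_scal.
    replace (2 * S m)%nat with (S (S (2 * m))) by lia.
    rewrite <- !Derive_n_Derive.
    set (X1 := op_chain L (fun y => Derive (Derive f) (s * (y - x0)) * trig a b y) x) in *.
    set (X2 := op_chain L (fun y => Derive f (s * (y - x0)) * trig (- (PI * b)) (PI * a) y) x) in *.
    set (X3 := op_chain L (fun y => f (s * (y - x0))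
      * trig ((PI ^ 2 - r) * a) ((PI ^ 2 - r) * b) y) x) in *.
    set (Y := Derive_n (Derive (Derive f)) (2 * m) (s * (x - x0)) * trig a b x) in *.
    replace (- s ^ 2 * X1 + 1 * (-2 * s * X2 + 1 * X3) - (-1) ^ S m * s ^ S (S (2 * m)) * Y)
      with (- s ^ 2 * (X1 - (-1) ^ m * s ^ (2 * m) * Y) + (-2 * s * X2 + X3)) by (simpl; ring).
    assert (T : Rabs (- s ^ 2 * (X1 - (-1) ^ m * s ^ (2 * m) * Y) + (-2 * s * X2 + X3))
      <= s ^ 2 * Rabs (X1 - (-1) ^ m * s ^ (2 * m) * Y) + (2 * s * Rabs X2 + Rabs X3)).
    { eapply Rle_trans; [apply Rabs_triang|]. apply Rplus_le_compat.
      - rewrite Rabs_mult, Rabs_Ropp, (Rabs_pos_eq (s ^ 2)) by apply pow2_ge_0. lra.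
      - eapply Rle_trans; [apply Rabs_triang|]. apply Rplus_le_compat_r.
        rewrite Rabs_mult, (Rabs_left (-2 * s)) by lra. lra. }
    set (Z := Rabs (X1 - _)) in *. clearbody Z.
    eapply Rle_trans; [apply Rmult_le_compat_l; [lra|exact T]|].
    assert (P : 0 < s ^ (2 * m)) by (apply pow_lt; lra).
    replace (s ^ S (S (2 * m))) with (s ^ 2 * s ^ (2 * m)) by (simpl; ring).
    set (q := s ^ (2 * m)) in *. clearbody q.
    replace ((C1 + 2 * C2 + C3) * (s ^ 2 * q))
      with (s ^ 2 * (C1 * q) + 2 * s ^ 2 * (C2 * q) + s ^ 2 * (C3 * q)) by ring.
    replace (s * (s ^ 2 * Z + (2 * s * Rabs X2 + Rabs X3)))
      with (s ^ 2 * (s * Z) + 2 * s ^ 2 * Rabs X2 + s * Rabs X3) by ring.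
    assert (Q2 : 0 <= s ^ 2) by apply pow2_ge_0.
    assert (s <= s ^ 2) by nra.
    pose proof (Rmult_le_compat_l _ _ _ Q2 H1). pose proof (Rmult_le_compat_l _ _ _ Q2 H2).
    assert (s * Rabs X3 <= s ^ 2 * (C3 * q)).
    { apply Rmult_le_compat; auto using Rabs_pos; lra. }
    lra.
Qed.

(** * Derivatives and energies of the bump *)

Lemma bounded_smooth_bump : bounded_smooth bump.
Proof.
  split; [apply smooth_bump|]. intros k.
  apply (bounded_off (Derive_n bump k) (-1) 1); [lra| |].
  - intros x. apply smooth_continuous, smooth_Derive_n, smooth_bump.
  - intros x [H|H]; apply off_eq, off_Derive_n.
    + apply (off_lt bump (-1)); auto. intros; apply bump_out; lra.
    + apply (off_gt bump 1); auto. intros; apply bump_out; lra.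
Qed.

Lemma off_bump (x : R) : x < -1 \/ 1 < x -> off bump x.
Proof.
  intros [H|H].
  - apply (off_lt bump (-1)); auto. intros; apply bump_out; lra.
  - apply (off_gt bump 1); auto. intros; apply bump_out; lra.
Qed.

Lemma Derive_n_bump_out (k : nat) (x : R) : x < -1 \/ 1 < x -> Derive_n bump k x = 0.
Proof. intros H. now apply off_eq, off_Derive_n, off_bump. Qed.

Lemma continuous_Derive_n_bump (k : nat) (x : R) : continuous (Derive_n bump k) x.
Proof. apply smooth_continuous, smooth_Derive_n, smooth_bump. Qed.

Lemma continuous_Rmult (f g : R -> R) (x : R) :
  continuous f x -> continuous g x -> continuous (fun y => f y * g y) x.
Proof. apply (continuous_mult (K := R_AbsRing)). Qed.

Lemma ex_RInt_continuous_R (f : R -> R) (a b : R) : (forall x, continuous f x) -> ex_RInt f a b.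
Proof. intros H. apply (ex_RInt_continuous (V := R_CompleteNormedModule)). auto. Qed.

(** Integration on [[-2, 2]], strictly larger than the support, makes the boundary terms vanish. *)
Lemma bump_ibp (i : nat) : forall a b,
  RInt (fun x => Derive_n bump (a + i) x * Derive_n bump b x) (-2) 2
  = (-1) ^ i * RInt (fun x => Derive_n bump a x * Derive_n bump (b + i) x) (-2) 2 :> R.
Proof.
  induction i as [|i IH]; intros a b.
  - rewrite !Nat.add_0_r, pow_O, Rmult_1_l. reflexivity.
  - replace (a + S i)%nat with (S a + i)%nat by lia. rewrite IH.
    replace (b + S i)%nat with (S (b + i)) by lia. set (c := (b + i)%nat).
    assert (E : RInt (fun x => 1 * (Derive_n bump (S a) x * Derive_n bump c x)
                   + 1 * (Derive_n bump a x * Derive_n bump (S c) x)) (-2) 2 = 0 :> R).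
    { rewrite (RInt_Derive_eq (fun x => Derive_n bump a x * Derive_n bump c x)).
      - rewrite !Derive_n_bump_out by lra. ring.
      - intros x. evar_last.
        + apply (is_derive_mult (K := R_AbsRing)).
          * apply smooth_is_derive, smooth_Derive_n, smooth_bump.
          * apply smooth_is_derive, smooth_Derive_n, smooth_bump.
          * intros; apply Rmult_comm.
        + simpl. unfold plus, mult; simpl. ring.
      - intros x. apply (continuous_plus (V := R_NormedModule));
        apply (continuous_scal_r (V := R_NormedModule)); apply continuous_Rmult;
        apply continuous_Derive_n_bump. }
    rewrite RInt_lin in E by (apply ex_RInt_continuous_R; intros; apply continuous_Rmult;
        apply continuous_Derive_n_bump).
    simpl pow. rewrite !Rmult_1_l in E.
    replace (RInt (fun x => Derive_n bump (S a) x * Derive_n bump c x) (-2) 2)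
      with (- RInt (fun x => Derive_n bump a x * Derive_n bump (S c) x) (-2) 2)
      by (apply eq_sym, Rplus_opp_r_uniq; rewrite Rplus_comm; exact E).
    ring.
Qed.

Lemma RInt_sqr_pos (g : R -> R) (a b y : R) : (forall x, continuous g x) -> a < y < b ->
  g y <> 0 -> 0 < RInt (fun x => g x * g x) a b.
Proof.
  intros Hc Hy Hg.
  assert (Hcc : forall x, continuous (fun x => g x * g x) x) by (intros; now apply continuous_Rmult).
  assert (L : locally y (fun z => 0 < Rabs (g z))).
  { assert (Hca : continuous (fun z => Rabs (g z)) y)
      by (apply (continuous_comp g Rabs); [apply Hc|apply continuous_Rabs]).
    apply Hca. apply (open_gt 0). now apply Rabs_pos_lt. }
  destruct L as [[del Hdel] L].
  set (e := Rmin (del / 2) (Rmin ((y - a) / 2) ((b - y) / 2))).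
  assert (He : 0 < e /\ e <= del / 2 /\ e <= (y - a) / 2 /\ e <= (b - y) / 2).
  { unfold e. repeat split.
    - repeat apply Rmin_glb_lt; lra.
    - apply Rmin_l.
    - eapply Rle_trans; [apply Rmin_r|apply Rmin_l].
    - eapply Rle_trans; [apply Rmin_r|apply Rmin_r]. }
  assert (EX : forall u v, ex_RInt (fun x => g x * g x) u v)
    by (intros; now apply ex_RInt_continuous_R).
  rewrite <- (RInt_Chasles (V := R_CompleteNormedModule) _ a (y - e) b) by auto.
  rewrite <- (RInt_Chasles (V := R_CompleteNormedModule) _ (y - e) (y + e) b) by auto.
  assert (0 <= RInt (fun x => g x * g x) a (y - e)).
  { apply RInt_ge_0; [lra|auto|]. intros; apply Rle_0_sqr. }
  assert (0 <= RInt (fun x => g x * g x) (y + e) b).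
  { apply RInt_ge_0; [lra|auto|]. intros; apply Rle_0_sqr. }
  assert (0 < RInt (fun x => g x * g x) (y - e) (y + e)).
  { apply RInt_gt_0; [lra| |auto]. intros x Hx.
    assert (0 < Rabs (g x)).
    { apply L. change (Rabs (x - y) < del). apply Rabs_lt_between. lra. }
    apply Rlt_0_sqr. intros E. rewrite E, Rabs_R0 in H1. lra. }
  unfold plus; simpl. lra.
Qed.

(** If the next derivative were identically zero, the [m]-th one would be constant, hence equal to
    its value [0] at [2]. *)
Lemma Derive_n_bump_nonzero (m : nat) : exists y, Derive_n bump m y <> 0.
Proof.
  induction m as [|m [y Hy]]; [exists 0; apply bump_0|].
  apply not_all_ex_not. intros H. apply Hy.
  assert (E : RInt (fun _ => 0) 2 y = Derive_n bump m y - Derive_n bump m 2 :> R).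
  { apply RInt_Derive_eq.
    - intros x. rewrite <- (H x). apply smooth_is_derive, smooth_Derive_n, smooth_bump.
    - intros x. apply continuous_const. }
  rewrite (RInt_const (V := R_CompleteNormedModule)) in E.
  change (scal (y - 2) 0) with ((y - 2) * 0) in E.
  rewrite (Derive_n_bump_out m 2) in E by lra. lra.
Qed.

(* Equal to the integral of the square of the [m]-th derivative, see [bump_ibp]. *)
Definition bump_energy (m : nat) : R :=
  RInt (fun x => (-1) ^ m * (Derive_n bump (2 * m) x * bump x)) (-2) 2.

Lemma bump_energy_pos (m : nat) : 0 < bump_energy m.
Proof.
  unfold bump_energy.
  rewrite (RInt_scal (V := R_CompleteNormedModule)) by (apply ex_RInt_continuous_R; intros;
    apply continuous_Rmult; [|apply (continuous_Derive_n_bump 0)]; apply continuous_Derive_n_bump).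
  pose proof (bump_ibp m m 0) as E. simpl plus in E.
  replace (m + m)%nat with (2 * m)%nat in E by lia.
  change (scal ((-1) ^ m) (RInt (fun x => Derive_n bump (2 * m) x * bump x) (-2) 2))
    with ((-1) ^ m * RInt (fun x => Derive_n bump (2 * m) x * Derive_n bump 0 x) (-2) 2).
  rewrite E, <- Rmult_assoc, <- Rpow_mult_distr. replace (-1 * -1) with 1 by ring.
  rewrite pow1, Rmult_1_l. destruct (Derive_n_bump_nonzero m) as [y Hy].
  apply (RInt_sqr_pos _ _ _ y); auto using continuous_Derive_n_bump.
  destruct (Rlt_dec y (-1)); [exfalso; apply Hy, Derive_n_bump_out; lra|].
  destruct (Rlt_dec 1 y); [exfalso; apply Hy, Derive_n_bump_out; lra|]. lra.
Qed.

(** * Asymptotics of the forms on a concentrating bump *)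

Lemma RInt_restrict (f : R -> R) (a b : R) : (forall x, continuous f x) ->
  0 <= a -> a <= b -> b <= 1 -> (forall x, x < a \/ b < x -> f x = 0) ->
  RInt f 0 1 = RInt f a b :> R.
Proof.
  intros Hc Ha Hab Hb H0.
  assert (EX : forall u v, ex_RInt f u v) by (intros; now apply ex_RInt_continuous_R).
  assert (Z : forall u v, u <= v -> (forall x, u < x < v -> f x = 0) -> RInt f u v = 0 :> R).
  { intros u v Huv H. rewrite (RInt_ext_R _ (fun _ => 0)) by auto.
    rewrite (RInt_const (V := R_CompleteNormedModule)). apply Rmult_0_r. }
  rewrite <- (RInt_Chasles (V := R_CompleteNormedModule) f 0 a 1) by auto.
  rewrite <- (RInt_Chasles (V := R_CompleteNormedModule) f a b 1) by auto.
  rewrite (Z 0 a), (Z b 1); auto; try (intros; apply H0; lra).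
  change (0 + (RInt f a b + 0) = RInt f a b). ring.
Qed.

Lemma lipschitz01 (g : R -> R) : smooth g ->
  exists D, 0 <= D /\ forall x y, 0 <= x <= 1 -> 0 <= y <= 1 ->
    Rabs (g x - g y) <= D * Rabs (x - y).
Proof.
  intros H. destruct (cont01_bounded (Derive g)) as [D [HD HB]].
  { now apply cont01_smooth, smooth_Derive. }
  exists D. split; auto. intros x y Hx Hy.
  destruct (MVT_gen g y x (Derive g)) as [c [Hc E]].
  - intros z _. now apply smooth_is_derive.
  - intros z _. apply continuity_pt_filterlim. now apply smooth_continuous.
  - rewrite E, Rabs_mult. apply Rmult_le_compat_r; [apply Rabs_pos|]. apply HB.
    revert Hc. unfold Rmin, Rmax. destruct (Rle_dec y x); lra.
Qed.

Definition weight (K : nat) (x : R) : R := phi 1 x * phi K x.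

Lemma smooth_weight (K : nat) : smooth (weight K).
Proof. apply smooth_mult; apply smooth_phi. Qed.

Definition scaled_bump (s x0 x : R) : R := bump (s * (x - x0)).

Lemma smooth_scaled_bump (s x0 : R) : smooth (scaled_bump s x0).
Proof. apply smooth_affine, smooth_bump. Qed.

Lemma phi_1_trig : phi 1 = trig (sqrt 2) 0.
Proof.
  apply functional_extensionality; intros x. unfold phi, trig. simpl. rewrite Rmult_1_l. ring.
Qed.

Lemma RInt_scaled (w : R -> R) (s x0 : R) : 0 < s -> (forall x, continuous w x) ->
  s * RInt (fun x => w (s * (x - x0))) (x0 - 2 / s) (x0 + 2 / s) = RInt w (-2) 2 :> R.
Proof.
  intros Hs Hw.
  assert (Hw' : forall x, continuous (fun x => w (s * (x - x0))) x).
  { intros x. apply (continuous_comp (fun x => s * (x - x0)) w); auto.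
    apply (ex_derive_continuous (V := R_NormedModule)). auto_derive; auto. }
  pose proof (RInt_comp_lin (V := R_CompleteNormedModule) w s (- s * x0) (x0 - 2 / s) (x0 + 2 / s)) as E.
  replace (s * (x0 - 2 / s) + - s * x0) with (-2) in E by (field; lra).
  replace (s * (x0 + 2 / s) + - s * x0) with 2 in E by (field; lra).
  rewrite <- E by now apply ex_RInt_continuous_R.
  rewrite (RInt_scal (V := R_CompleteNormedModule)).
  - apply f_equal. apply RInt_ext_R.
    + assert (0 < 2 / s) by (apply Rdiv_lt_0_compat; lra). lra.
    + intros x _. f_equal. ring.
  - apply (ex_RInt_ext (V := R_NormedModule) (fun x => w (s * (x - x0)))).
    + intros x _. f_equal. ring.
    + now apply ex_RInt_continuous_R.
Qed.

(** Two replacements inside the integral, each with relative error of order [1 / s]: the operator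
    chain by its leading term, and [weight K x] by [weight K x0]. What remains rescales exactly to
    [bump_energy]. *)
Lemma concentration (L : list R) (K : nat) (x0 : R) :
  exists C, 0 <= C /\ forall s, 1 <= s -> 0 <= x0 - 2 / s -> x0 + 2 / s <= 1 ->
    s * Rabs (s * ip (op_chain L (fun y => scaled_bump s x0 y * phi 1 y))
                     (fun y => scaled_bump s x0 y * phi K y)
              - s ^ (2 * length L) * (weight K x0 * bump_energy (length L)))
    <= C * s ^ (2 * length L).
Proof.
  set (m := length L).
  destruct (op_chain_bump L bump (sqrt 2) 0 bounded_smooth_bump) as [C1 [HC1 H1]].
  destruct (proj2 bounded_smooth_bump 0%nat) as [B0 [HB0 Hb0]].
  destruct (proj2 bounded_smooth_bump (2 * m)%nat) as [B2 [HB2 Hb2]].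
  destruct (lipschitz01 _ (smooth_weight K)) as [D [HD HDl]].
  assert (S2 := sqrt_pos 2).
  (* The first summand pays for the leading-term replacement, the second for freezing the weight at
     distance at most [2 / s] from [x0]. *)
  set (C := C1 * (B0 * sqrt 2) + B2 * B0 * (D * 2)).
  assert (HC : 0 <= C).
  { assert (0 <= C1 * (B0 * sqrt 2)) by (repeat apply Rmult_le_pos; auto).
    assert (0 <= B2 * B0 * (D * 2)) by (repeat apply Rmult_le_pos; auto; lra).
    unfold C; lra. }
  (* The integration window has length [4 / s]. *)
  exists (4 * C). split; [lra|].
  intros s Hs Hl Hr. specialize (H1 s x0).
  set (X := op_chain L (fun y => scaled_bump s x0 y * phi 1 y)).
  set (v := fun y => scaled_bump s x0 y * phi K y).
  set (W := fun y => (-1) ^ m * (Derive_n bump (2 * m) y * bump y)).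
  assert (SX : smooth X).
  { apply smooth_op_chain, smooth_mult; auto using smooth_scaled_bump, smooth_phi. }
  assert (Sv : smooth v) by (apply smooth_mult; auto using smooth_scaled_bump, smooth_phi).
  assert (Hd : 0 < 2 / s) by (apply Rdiv_lt_0_compat; lra).
  assert (CW : forall x, continuous W x).
  { intros x. apply continuous_Rmult; [apply continuous_const|].
    apply continuous_Rmult; [|apply (continuous_Derive_n_bump 0)]; apply continuous_Derive_n_bump. }
  assert (CI : forall x, continuous (fun x => X x * v x) x).
  { intros x. apply continuous_Rmult; now apply smooth_continuous. }
  assert (CWs : forall x, continuous (fun x => W (s * (x - x0))) x).
  { intros x. apply (continuous_comp (fun x => s * (x - x0)) W); auto.
    apply (ex_derive_continuous (V := R_NormedModule)). auto_derive; auto. }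
  assert (P : 0 < s ^ (2 * m)) by (apply pow_lt; lra).
  assert (E : ip X v = RInt (fun x => X x * v x) (x0 - 2 / s) (x0 + 2 / s)).
  { unfold ip. apply RInt_restrict; auto; [lra|]. intros x Hx.
    unfold v, scaled_bump. rewrite bump_out; [ring|].
    replace (2 / s) with (2 * / s) in Hx by reflexivity.
    assert (s * / s = 1) by (apply Rinv_r; lra).
    assert (0 < / s) by (apply Rinv_0_lt_compat; lra).
    destruct Hx; [left|right]; nra. }
  assert (EW := RInt_scaled W s x0 ltac:(lra) CW). fold (bump_energy m) in EW.
  change (RInt W (-2) 2) with (bump_energy m) in EW.
  assert (EQ : s * ip X v - s ^ (2 * m) * (weight K x0 * bump_energy m)
     = s * RInt (fun x => 1 * (X x * v x) + (- (s ^ (2 * m) * weight K x0)) * W (s * (x - x0)))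
              (x0 - 2 / s) (x0 + 2 / s)).
  { rewrite RInt_lin by now apply ex_RInt_continuous_R. rewrite E, <- EW. ring. }
  rewrite EQ, Rabs_mult, (Rabs_pos_eq s) by lra.
  assert (BD : Rabs (RInt (fun x => 1 * (X x * v x)
       + (- (s ^ (2 * m) * weight K x0)) * W (s * (x - x0))) (x0 - 2 / s) (x0 + 2 / s))
     <= ((x0 + 2 / s) - (x0 - 2 / s)) * (C * s ^ (2 * m) / s)).
  { apply abs_RInt_le_const; [lra| |].
    - apply ex_RInt_continuous_R. intros x. apply (continuous_plus (V := R_NormedModule));
      apply (continuous_scal_r (V := R_NormedModule)); auto.
    - intros x Hx. specialize (H1 x Hs). fold m in H1.
      change (op_chain L (fun y => bump (s * (y - x0)) * trig (sqrt 2) 0 y) x)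
        with (op_chain L (fun y => scaled_bump s x0 y * trig (sqrt 2) 0 y) x) in H1.
      rewrite <- phi_1_trig in H1. fold X in H1.
      set (l := (-1) ^ m * s ^ (2 * m) * (Derive_n bump (2 * m) (s * (x - x0)) * phi 1 x)) in *.
      replace (1 * (X x * v x) + - (s ^ (2 * m) * weight K x0) * W (s * (x - x0)))
        with ((X x - l) * v x
              + (-1) ^ m * s ^ (2 * m) * (Derive_n bump (2 * m) (s * (x - x0))
                 * bump (s * (x - x0))) * (weight K x - weight K x0))
        by (unfold l, W, v, weight, scaled_bump; ring).
      apply (Rmult_le_reg_l s); [lra|].
      replace (s * (C * s ^ (2 * m) / s)) with (C * s ^ (2 * m)) by (field; lra).
      eapply Rle_trans; [apply Rmult_le_compat_l; [lra|apply Rabs_triang]|].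
      rewrite Rmult_plus_distr_l. unfold C. rewrite (Rmult_plus_distr_r (C1 * _)).
      apply Rplus_le_compat.
      + rewrite Rabs_mult, <- Rmult_assoc.
        replace (C1 * (B0 * sqrt 2) * s ^ (2 * m)) with ((C1 * s ^ (2 * m)) * (B0 * sqrt 2)) by ring.
        apply Rmult_le_compat; [apply Rmult_le_pos; [lra|apply Rabs_pos]|apply Rabs_pos|exact H1|].
        unfold v, scaled_bump. rewrite Rabs_mult.
        apply Rmult_le_compat; auto using Rabs_pos, phi_bound.
      + rewrite !Rabs_mult, pow_1_abs, (Rabs_pos_eq (s ^ (2 * m))), Rmult_1_l by lra.
        assert (T : s * Rabs (weight K x - weight K x0) <= D * 2).
        { assert (Rabs (weight K x - weight K x0) <= D * (2 / s)).
          { eapply Rle_trans; [apply HDl; lra|]. apply Rmult_le_compat_l; auto.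
            apply Rabs_le. lra. }
          apply (Rmult_le_compat_l s) in H; [|lra].
          replace (s * (D * (2 / s))) with (D * 2) in H by (field; lra). exact H. }
        replace (s * (s ^ (2 * m) * (Rabs (Derive_n bump (2 * m) (s * (x - x0)))
            * Rabs (bump (s * (x - x0)))) * Rabs (weight K x - weight K x0)))
          with ((Rabs (Derive_n bump (2 * m) (s * (x - x0))) * Rabs (bump (s * (x - x0))))
             * (s * Rabs (weight K x - weight K x0)) * s ^ (2 * m)) by ring.
        apply Rmult_le_compat_r; [lra|].
        apply Rmult_le_compat; auto.
        * apply Rmult_le_pos; apply Rabs_pos.
        * apply Rmult_le_pos; [lra|apply Rabs_pos].
        * apply Rmult_le_compat; auto using Rabs_pos. }
  apply (Rmult_le_compat_l (s * s)) in BD; [|nra].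
  rewrite <- Rmult_assoc. eapply Rle_trans; [exact BD|]. right. field. lra.
Qed.

Lemma uniform_threshold (P : nat -> R -> Prop) :
  (forall p, exists S, forall s, S <= s -> P p s) ->
  forall n, exists S, forall s, S <= s -> forall p, (p <= n)%nat -> P p s.
Proof.
  intros H n. induction n as [|n [S1 IH]].
  - destruct (H O) as [S0 H0]. exists S0. intros s Hs p Hp. replace p with O by lia. auto.
  - destruct (H (S n)) as [S0 H0]. exists (Rmax S1 S0). intros s Hs p Hp.
    pose proof (Rmax_l S1 S0). pose proof (Rmax_r S1 S0).
    destruct (Nat.eq_dec p (S n)) as [->|]; [apply H0; lra|apply IH; [lra|lia]].
Qed.

Lemma off_scaled_bump (s x0 d x : R) : 1 <= s -> 2 / s <= d ->
  x < x0 - d \/ x0 + d < x -> off (scaled_bump s x0) x.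
Proof.
  intros Hs Hd Hx. unfold Rdiv in Hd.
  assert (s * / s = 1) by (apply Rinv_r; lra).
  assert (0 < / s) by (apply Rinv_0_lt_compat; lra).
  destruct Hx as [Hx|Hx].
  - apply (off_lt _ (x0 - d)); auto. intros y Hy. apply bump_out. left. nra.
  - apply (off_gt _ (x0 + d)); auto. intros y Hy. apply bump_out. right. nra.
Qed.

Lemma flat_scaled_bump (s x0 d : R) : 1 <= s -> 2 / s <= d -> 0 < x0 - d -> x0 + d < 1 ->
  flat (scaled_bump s x0).
Proof.
  intros Hs Hd H0 H1. split; [apply smooth_scaled_bump|].
  split; apply (off_scaled_bump s x0 d); auto.
Qed.

(** The exponent is twice the number [2 p - 1] of operators; the factor [s] in front of [A] undoes
    the [1 / s] from the change of variables. *)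
Lemma concentration_A (K p : nat) (x0 d : R) : (1 <= p)%nat -> 0 < d -> 0 < x0 - d -> x0 + d < 1 ->
  exists C, 0 <= C /\ forall s, 1 <= s -> 2 / s <= d ->
    s * Rabs (s * A (scaled_bump s x0) K p
              - s ^ (4 * p - 2) * (weight K x0 * bump_energy (2 * p - 1)))
    <= C * s ^ (4 * p - 2).
Proof.
  intros Hp Hd H0 H1. destruct (concentration (roots K p) K x0) as [C [HC H]].
  exists C. split; auto. intros s Hs Hsd.
  rewrite A_eq_ip by now apply (flat_scaled_bump s x0 d).
  specialize (H s Hs ltac:(lra) ltac:(lra)). rewrite length_roots in H by auto.
  replace (2 * (2 * p - 1))%nat with (4 * p - 2)%nat in H by lia. exact H.
Qed.

Lemma bump_dominates (K n : nat) (x0 d sg M : R) : (1 <= n)%nat ->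
  0 < d -> 0 < x0 - d -> x0 + d < 1 -> sg = 1 \/ sg = -1 -> 0 < sg * weight K x0 -> 0 <= M ->
  exists s, 1 <= s /\ 2 / s <= d /\ 0 < sg * A (scaled_bump s x0) K n /\
    forall p, (1 <= p < n)%nat ->
      M * Rabs (A (scaled_bump s x0) K p) < sg * A (scaled_bump s x0) K n.
Proof.
  intros Hn Hd H0 H1 Hsg Hw HM.
  destruct (concentration_A K n x0 d Hn Hd H0 H1) as [C [HC HCn]].
  (* Half of the limiting coefficient: once [s >= C / ka], the error costs at most the other
     half. *)
  set (ka := sg * weight K x0 * bump_energy (2 * n - 1) / 2).
  assert (Hka : 0 < ka).
  { pose proof (bump_energy_pos (2 * n - 1)). unfold ka.
    apply Rdiv_lt_0_compat; [now apply Rmult_lt_0_compat|lra]. }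
  assert (LB : forall s, 1 <= s -> 2 / s <= d -> C / ka <= s ->
    ka * s ^ (4 * n - 2) <= sg * (s * A (scaled_bump s x0) K n)).
  { intros s Hs Hsd Hsk. specialize (HCn s Hs Hsd).
    assert (P : 0 < s ^ (4 * n - 2)) by (apply pow_lt; lra).
    set (q := s ^ (4 * n - 2)) in *. set (a := s * A (scaled_bump s x0) K n) in *.
    set (e := weight K x0 * bump_energy (2 * n - 1)) in *.
    assert (Hck : C <= ka * s).
    { apply (Rmult_le_compat_l ka) in Hsk; [|lra].
      replace (ka * (C / ka)) with C in Hsk by (field; lra). exact Hsk. }
    assert (T : Rabs (a - q * e) <= ka * q).
    { apply (Rmult_le_reg_l s); [lra|]. eapply Rle_trans; [exact HCn|]. nra. }
    assert (E2 : sg * e = 2 * ka) by (unfold ka, e; field).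
    apply Rabs_le_between in T.
    destruct Hsg as [->| ->]; nra. }
  set (Pr := fun (p : nat) (s : R) => 1 <= s -> 2 / s <= d -> (1 <= p < n)%nat ->
    M * (s * Rabs (A (scaled_bump s x0) K p)) < ka * s ^ (4 * n - 2)).
  assert (HPr : forall p, exists S, forall s, S <= s -> Pr p s).
  { intros p. destruct (Compare_dec.le_lt_dec 1 p) as [Hp|Hp].
    2:{ exists 0. intros s _ _ _ Hp'. lia. }
    destruct (concentration_A K p x0 d Hp Hd H0 H1) as [Cp [HCp Hc]].
    set (Dp := Cp + Rabs (weight K x0 * bump_energy (2 * p - 1))).
    assert (HDp : 0 <= Dp) by (pose proof (Rabs_pos (weight K x0 * bump_energy (2 * p - 1)));
      unfold Dp; lra).
    exists (M * Dp / ka + 1). intros s HS Hs Hsd Hpn. specialize (Hc s Hs Hsd).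
    assert (P : 0 < s ^ (4 * p - 2)) by (apply pow_lt; lra).
    (* Since [p < n], the exponents differ by at least [4]; one spare factor [s] suffices to beat
       the constant [M * Dp / ka]. *)
    assert (PP : s * s ^ (4 * p - 2) <= s ^ (4 * n - 2)).
    { change (s ^ S (4 * p - 2) <= s ^ (4 * n - 2)). apply Rle_pow; [lra|lia]. }
    assert (HMk : M * Dp < ka * s).
    { apply (Rmult_lt_reg_l (/ ka)); [now apply Rinv_0_lt_compat|].
      replace (/ ka * (ka * s)) with s by (field; lra).
      replace (/ ka * (M * Dp)) with (M * Dp / ka) by (field; lra). lra. }
    assert (UB : s * Rabs (A (scaled_bump s x0) K p) <= Dp * s ^ (4 * p - 2)).
    { set (e := weight K x0 * bump_energy (2 * p - 1)) in *.
      set (q := s ^ (4 * p - 2)) in *. set (a := A (scaled_bump s x0) K p) in *.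
      rewrite <- (Rabs_pos_eq s) at 1 by lra. rewrite <- Rabs_mult.
      replace (s * a) with ((s * a - q * e) + q * e) by ring.
      eapply Rle_trans; [apply Rabs_triang|]. rewrite (Rabs_mult q), (Rabs_pos_eq q) by lra.
      pose proof (Rabs_pos (s * a - q * e)). unfold Dp. nra. }
    apply (Rmult_lt_reg_l s); [lra|].
    apply Rle_lt_trans with (M * Dp * (s * s ^ (4 * p - 2))).
    { replace (M * Dp * (s * s ^ (4 * p - 2))) with (s * (M * (Dp * s ^ (4 * p - 2)))) by ring.
      apply Rmult_le_compat_l; [lra|]. now apply Rmult_le_compat_l. }
    assert (0 < s ^ (4 * n - 2)) by (apply pow_lt; lra).
    apply Rle_lt_trans with (M * Dp * s ^ (4 * n - 2)).
    { apply Rmult_le_compat_l; auto. now apply Rmult_le_pos. }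
    replace (s * (ka * s ^ (4 * n - 2))) with (ka * s * s ^ (4 * n - 2)) by ring.
    now apply Rmult_lt_compat_r. }
  destruct (uniform_threshold Pr HPr n) as [S0 HS0].
  set (s := Rmax (Rmax 1 (2 / d)) (Rmax (C / ka) S0)).
  assert (I1 : 1 <= s) by (eapply Rle_trans; [apply Rmax_l|apply Rmax_l]).
  assert (I2 : 2 / d <= s) by (eapply Rle_trans; [apply Rmax_r|apply Rmax_l]).
  assert (I3 : C / ka <= s) by (eapply Rle_trans; [apply Rmax_l|apply Rmax_r]).
  assert (I4 : S0 <= s) by (eapply Rle_trans; [apply Rmax_r|apply Rmax_r]).
  assert (I2' : 2 / s <= d).
  { apply (Rmult_le_reg_l s); [lra|]. replace (s * (2 / s)) with 2 by (field; lra).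
    apply (Rmult_le_compat_l d) in I2; [|lra].
    replace (d * (2 / d)) with 2 in I2 by (field; lra). lra. }
  specialize (LB s I1 I2' I3).
  assert (P : 0 < s ^ (4 * n - 2)) by (apply pow_lt; lra).
  assert (Pk : 0 < ka * s ^ (4 * n - 2)) by now apply Rmult_lt_0_compat.
  exists s. repeat split; auto.
  - apply (Rmult_lt_reg_l s); [lra|]. lra.
  - intros p Hp. specialize (HS0 s I4 p ltac:(lia) I1 I2' Hp).
    apply (Rmult_lt_reg_l s); [lra|]. lra.
Qed.

(** * Elimination of the lower forms *)

(** The operators are differential, hence local: they do not enlarge supports, so both cross terms
    of the quadratic form vanish pointwise. *)
Lemma A_disjoint (f g : R -> R) (a b : R) (K p : nat) : flat f -> flat g ->
  (forall x, off f x \/ off g x) ->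
  A (fun x => a * f x + b * g x) K p = a ^ 2 * A f K p + b ^ 2 * A g K p.
Proof.
  intros Hf Hg Hd.
  assert (Hfg : flat (fun x => a * f x + b * g x)).
  { destruct Hf as (Sf & F0 & F1), Hg as (Sg & G0 & G1).
    repeat split; auto using smooth_plus, smooth_scal, off_lin. }
  rewrite !A_eq_ip by auto.
  replace (fun x => (a * f x + b * g x) * phi 1 x)
    with (fun x => a * (f x * phi 1 x) + b * (g x * phi 1 x))
    by (apply functional_extensionality; intros; ring).
  destruct Hf as [Sf _], Hg as [Sg _].
  assert (Sp : forall j, smooth (phi j)) by apply smooth_phi.
  rewrite op_chain_lin by auto using smooth_mult. set (L := roots K p).
  set (X := op_chain L (fun x => f x * phi 1 x)). set (Y := op_chain L (fun x => g x * phi 1 x)).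
  assert (SX : smooth X) by (apply smooth_op_chain, smooth_mult; auto).
  assert (SY : smooth Y) by (apply smooth_op_chain, smooth_mult; auto).
  unfold ip. rewrite <- RInt_lin
    by (apply ex_RInt_cont01, cont01_mult; [|apply cont01_mult]; now apply cont01_smooth).
  apply RInt_ext_R; [lra|]. intros x _.
  destruct (Hd x) as [Ho|Ho].
  - assert (X x = 0) by now apply off_eq, off_op_chain, off_mult_l.
    rewrite H, (off_eq f x Ho). ring.
  - assert (Y x = 0) by now apply off_eq, off_op_chain, off_mult_l.
    rewrite H, (off_eq g x Ho). ring.
Qed.

(** Support in the union of two intervals, meant for one in each sign region of [weight K]. *)
Definition supported_in (a b a' b' : R) (mu : R -> R) : Prop :=
  smooth mu /\ forall x, x < a \/ b < x -> x < a' \/ b' < x -> off mu x.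

Lemma supported_in_flat (a b a' b' : R) (mu : R -> R) : 0 < a -> a < b -> b < a' -> a' < b' ->
  b' < 1 -> supported_in a b a' b' mu -> flat mu.
Proof. intros ? ? ? ? ? [H Ho]. repeat split; auto; apply Ho; lra. Qed.

Lemma supported_in_sub (a b a' b' c d c' d' : R) (mu : R -> R) :
  c <= a -> b <= d -> c' <= a' -> b' <= d' ->
  supported_in a b a' b' mu -> supported_in c d c' d' mu.
Proof. intros ? ? ? ? [H Ho]. split; auto. intros x L1 L2. apply Ho; lra. Qed.

Lemma supported_in_lin (a b a' b' s t : R) (f g : R -> R) :
  supported_in a b a' b' f -> supported_in a b a' b' g ->
  supported_in a b a' b' (fun x => s * f x + t * g x).
Proof.
  intros [Sf Of] [Sg Og]. split; [auto using smooth_plus, smooth_scal|].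
  intros x H1 H2. apply off_lin; auto.
Qed.

Lemma supported_in_disjoint (a b a' b' c d c' d' : R) (f g : R -> R) :
  b < c -> d < a' -> b' < c' ->
  supported_in a b a' b' f -> supported_in c d c' d' g ->
  a < b -> a' < b' -> c < d -> c' < d' -> forall x, off f x \/ off g x.
Proof.
  intros H1 H2 H3 [_ Of] [_ Og] ? ? ? ? x.
  destruct (Rlt_dec b x); destruct (Rlt_dec x a'); destruct (Rlt_dec b' x);
  destruct (Rlt_dec x c); destruct (Rlt_dec x c'); destruct (Rlt_dec d x);
  solve [left; apply Of; lra | right; apply Og; lra].
Qed.

(* Each step adds to [f] a piece [t * g] of disjoint support, with [g] killing the forms of
   index at most [k], so that only the forms from [k + 1] on are changed; the domination
   by the form of index [n] is what keeps the sign of that form. *)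
Lemma eliminate_lower_forms (K k : nat) : forall (n : nat) (a b a' b' sg M : R),
  (k < n)%nat -> 0 < a -> a < b -> b < a' -> a' < b' -> b' < 1 ->
  (forall x, a <= x <= b -> 0 < weight K x) -> (forall x, a' <= x <= b' -> weight K x < 0) ->
  sg = 1 \/ sg = -1 -> 0 <= M ->
  exists mu, supported_in a b a' b' mu /\
    (forall p, (1 <= p <= k)%nat -> A mu K p = 0) /\
    0 < sg * A mu K n /\
    (forall p, (k < p < n)%nat -> M * Rabs (A mu K p) < sg * A mu K n).
Proof.
  induction k as [|k IH]; intros n a b a' b' sg M Hkn Ha Hab Hba Hab' Hb' Hpos Hneg Hsg HM.
  - assert (X : exists x0 d, 0 < d /\ 0 < x0 - d /\ x0 + d < 1 /\ 0 < sg * weight K x0 /\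
       (a = x0 - d /\ b = x0 + d \/ a' = x0 - d /\ b' = x0 + d)).
    { destruct Hsg as [->| ->].
      - exists ((a + b) / 2), ((b - a) / 2). repeat split; try lra.
        pose proof (Hpos ((a + b) / 2)). lra.
      - exists ((a' + b') / 2), ((b' - a') / 2). repeat split; try lra.
        pose proof (Hneg ((a' + b') / 2)). lra. }
    destruct X as (x0 & d & Hd & H0 & H1 & Hw & Hx).
    destruct (bump_dominates K n x0 d sg M) as (s & Hs & Hsd & Hp & Hdom); auto.
    exists (scaled_bump s x0). split; [|split; [|split; [exact Hp|]]].
    + split; [apply smooth_scaled_bump|].
      intros x L1 L2. apply (off_scaled_bump s x0 d); auto. lra.
    + intros p Hp'. lia.
    + intros p Hp'. apply Hdom. lia.
  (* The main piece will use the left thirds of both intervals and the correcting piece the right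
     thirds; the middle thirds separate them. *)
  - set (m1 := (2 * a + b) / 3). set (m2 := (a + 2 * b) / 3).
    set (m1' := (2 * a' + b') / 3). set (m2' := (a' + 2 * b') / 3).
    assert (Hm : a < m1 /\ m1 < m2 /\ m2 < b) by (unfold m1, m2; lra).
    assert (Hm' : a' < m1' /\ m1' < m2' /\ m2' < b') by (unfold m1', m2'; lra).
    (* The induction hypothesis is used with top index [S k]: the first [k] forms vanish and the
       next one has a prescribed sign. No form lies strictly between, so the domination factor can
       be [0]. *)
    assert (G : forall tau, tau = 1 \/ tau = -1 -> exists g, supported_in m2 b m2' b' g /\
       (forall p, (1 <= p <= k)%nat -> A g K p = 0) /\ 0 < tau * A g K (S k)).
    { intros tau Htau. destruct (IH (S k) m2 b m2' b' tau 0) as (g & G1 & G2 & G3 & _);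
        auto; try lra; try (intros; apply Hpos; lra); try (intros; apply Hneg; lra).
      exists g; auto. }
    destruct (G 1) as (gp & Sgp & Zgp & Pgp); [lra|].
    destruct (G (-1)) as (gm & Sgm & Zgm & Pgm); [lra|]. clear G.
    destruct (uniform_threshold (fun p r => Rabs (A gp K p) <= r * A gp K (S k) /\
       Rabs (A gm K p) <= r * - A gm K (S k))) with (n := n) as [S0 HS0].
    { intros p. exists (Rmax (Rabs (A gp K p) / A gp K (S k)) (Rabs (A gm K p) / - A gm K (S k))).
      intros r Hr.
      pose proof (Rmax_l (Rabs (A gp K p) / A gp K (S k)) (Rabs (A gm K p) / - A gm K (S k))).
      pose proof (Rmax_r (Rabs (A gp K p) / A gp K (S k)) (Rabs (A gm K p) / - A gm K (S k))).
      split; apply Rle_div_l; lra. }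
    set (R0 := Rmax S0 0). assert (HR0 : 0 <= R0) by apply Rmax_r.
    specialize (HS0 R0 (Rmax_l _ _)).
    (* Chosen after [R0], so that half of the [n]-th form of [f] covers [(M + 1) * (R0 * Rabs e)],
       the total effect of the correction, and the other half covers [M] times the intermediate
       forms of [f]. *)
    set (M' := 2 * (M + 1) * (1 + R0)).
    destruct (IH n a m1 a' m1' sg M') as (f & Sf & Zf & Pf & Df); auto; try lra; try lia;
      try (intros; apply Hpos; lra); try (intros; apply Hneg; lra).
    { unfold M'. apply Rmult_le_pos; lra. }
    set (e := A f K (S k)).
    (* Solving [e + t ^ 2 * A g K (S k) = 0] requires [g] of sign opposite to [e]: [gm] if [e >= 0],
       [gp] otherwise, with [t ^ 2] the ratio of absolute values. This ratio times [R0] bounds the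
       side effects on the other forms. *)
    assert (X : exists g t, supported_in m2 b m2' b' g /\
       (forall p, (1 <= p <= k)%nat -> A g K p = 0) /\ e + t ^ 2 * A g K (S k) = 0 /\
       forall p, (p <= n)%nat -> Rabs (t ^ 2 * A g K p) <= R0 * Rabs e).
    { assert (Y : forall g q, 0 < q -> Rabs (A g K (S k)) = q -> e * A g K (S k) <= 0 ->
         (forall p, (p <= n)%nat -> Rabs (A g K p) <= R0 * q) ->
         exists t, e + t ^ 2 * A g K (S k) = 0 /\
           forall p, (p <= n)%nat -> Rabs (t ^ 2 * A g K p) <= R0 * Rabs e).
      { intros g q Hq E1 E2 E3. exists (sqrt (Rabs e / q)).
        assert (Hn : 0 <= Rabs e / q) by (apply Rdiv_le_0_compat; auto using Rabs_pos).
        rewrite pow2_sqrt by auto. split.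
        - apply (Rmult_eq_reg_r q); [|lra]. rewrite Rmult_plus_distr_r, Rmult_0_l.
          replace (Rabs e / q * A g K (S k) * q) with (Rabs e * A g K (S k)) by (field; lra).
          rewrite <- E1. unfold Rabs. destruct (Rcase_abs e); destruct (Rcase_abs (A g K (S k)));
          try ring; destruct (Req_dec e 0) as [->|]; try ring; nra.
        - intros p Hp. rewrite Rabs_mult, (Rabs_pos_eq (Rabs e / q)) by auto.
          specialize (E3 p Hp). apply (Rmult_le_compat_l _ _ _ Hn) in E3.
          replace (Rabs e / q * (R0 * q)) with (R0 * Rabs e) in E3 by (field; lra). exact E3. }
      destruct (Rle_dec 0 e) as [He|He].
      - destruct (Y gm (- A gm K (S k))) as [t [T1 T2]]; try lra.
        + rewrite Rabs_left; lra.
        + nra.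
        + intros p Hp. apply HS0; auto.
        + exists gm, t; auto.
      - destruct (Y gp (A gp K (S k))) as [t [T1 T2]]; try lra.
        + rewrite Rabs_pos_eq; lra.
        + nra.
        + intros p Hp. apply HS0; auto.
        + exists gp, t; auto. }
    destruct X as (g & t & Sg & Zg & Et & Bt).
    assert (AD : forall p, A (fun x => 1 * f x + t * g x) K p = A f K p + t ^ 2 * A g K p).
    { intros p. rewrite A_disjoint; [ring| | |].
      - apply (supported_in_flat a m1 a' m1'); auto; lra.
      - apply (supported_in_flat m2 b m2' b'); auto; lra.
      - apply (supported_in_disjoint a m1 a' m1' m2 b m2' b'); auto; lra. }
    exists (fun x => 1 * f x + t * g x).
    set (Y := sg * A f K n) in *.
    assert (He : M' * Rabs e < Y \/ (S k = n)%nat).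
    { destruct (Nat.eq_dec (S k) n); [now right|left]. apply Df. lia. }
    destruct He as [He|He]; [|lia].
    assert (LB : Y - R0 * Rabs e <= sg * A (fun x => 1 * f x + t * g x) K n).
    { rewrite AD. specialize (Bt n (le_n n)). apply Rabs_le_between in Bt. unfold Y.
      destruct Hsg as [->| ->]; lra. }
    assert (Pe := Rabs_pos e).
    assert (Hb : 2 * ((M + 1) * (R0 * Rabs e)) <= Y).
    { unfold M' in He. assert (0 <= (M + 1) * Rabs e) by (apply Rmult_le_pos; lra). lra. }
    assert (Hb1 : 0 <= M * (R0 * Rabs e)) by (repeat apply Rmult_le_pos; auto).
    split; [|split; [|split]].
    + apply supported_in_lin; [apply (supported_in_sub a m1 a' m1')|
        apply (supported_in_sub m2 b m2' b')]; auto; lra.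
    + intros p Hp. rewrite AD. destruct (Nat.eq_dec p (S k)) as [->|]; [exact Et|].
      rewrite Zf, Zg by lia. ring.
    + lra.
    + intros p Hp. eapply Rlt_le_trans; [|exact LB]. rewrite AD.
      specialize (Df p ltac:(lia)). specialize (Bt p ltac:(lia)).
      assert (Rabs (A f K p + t ^ 2 * A g K p) <= Rabs (A f K p) + R0 * Rabs e).
      { eapply Rle_trans; [apply Rabs_triang|]. lra. }
      apply Rle_lt_trans with (M * (Rabs (A f K p) + R0 * Rabs e)).
      { now apply Rmult_le_compat_l. }
      assert (Pa := Rabs_pos (A f K p)).
      assert (2 * ((M + 1) * Rabs (A f K p)) <= M' * Rabs (A f K p)).
      { unfold M'. assert (0 <= (M + 1) * Rabs (A f K p) * R0) by (repeat apply Rmult_le_pos; lra).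
        lra. }
      lra.
Qed.

(** * Sign regions of the weight and the final combination *)

Lemma weight_sign (K : nat) (x : R) : (2 <= K)%nat ->
  (0 < INR K * x < 1 -> 0 < weight K x) /\ (1 < INR K * x < 2 -> weight K x < 0).
Proof.
  intros HK. assert (HK' : 2 <= INR K) by (apply (le_INR 2); auto).
  assert (P := PI_RGT_0). assert (S2 : 0 < sqrt 2) by (apply sqrt_lt_R0; lra).
  assert (E : weight K x = 2 * sin (PI * x) * sin (INR K * x * PI)).
  { unfold weight, phi. rewrite <- sqrt2_sqr at 3. simpl INR.
    replace (1 * PI * x) with (PI * x) by ring.
    replace (INR K * x * PI) with (INR K * PI * x) by ring. ring. }
  (* In both cases [0 < x < 2 / K <= 1], so [sin (PI * x)] is positive and the second sine decides
     the sign. *)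
  rewrite E. split; intros Hx.
  - assert (0 < sin (PI * x)) by (apply sin_gt_0; nra).
    assert (0 < sin (INR K * x * PI)) by (apply sin_gt_0; nra). nra.
  - assert (0 < sin (PI * x)) by (apply sin_gt_0; nra).
    assert (sin (INR K * x * PI) < 0) by (apply sin_lt_0; nra). nra.
Qed.

Theorem theoremA1 (K n : nat) (HK : (2 <= K)%nat) (Hn : (1 <= n)%nat) :
  exists mu : R -> R,
    smooth mu /\ compact_support_in_01 mu /\ H1 mu K /\ H2 mu K n.
Proof.
  assert (HK' : 2 <= INR K) by (apply (le_INR 2); auto).
  set (u := / INR K).
  assert (Hu : INR K * u = 1) by (apply Rinv_r; lra).
  assert (Hu0 : 0 < u) by (apply Rinv_0_lt_compat; lra).
  assert (Hu1 : 2 * u <= 1) by nra.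
  assert (W1 : forall x, 0 < x < u -> 0 < weight K x).
  { intros x Hx. apply weight_sign; auto. nra. }
  assert (W2 : forall x, u < x < 2 * u -> weight K x < 0).
  { intros x Hx. apply weight_sign; auto. nra. }
  (* With [u = 1 / K], the weight is positive on [(0, u)] and negative on [(u, 2 u)]. The offset [i]
     places an interval of length [0.1 u] in each; the bound [0.9] keeps it there, and the offsets
     [0.2] and [0.6] give disjoint supports. *)
  assert (G : forall i, 0 < i < 0.9 -> exists mu,
     supported_in (i * u) ((i + 0.1) * u) ((1 + i) * u) ((1 + i + 0.1) * u) mu /\
     (forall p, (1 <= p <= n - 1)%nat -> A mu K p = 0) /\ 0 < A mu K n).
  { intros i Hi.
    destruct (eliminate_lower_forms K (n - 1) n (i * u) ((i + 0.1) * u) ((1 + i) * u)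
      ((1 + i + 0.1) * u) 1 0) as (mu & S & Z & P & _); try lia; try nra.
    - intros x Hx. apply W1. nra.
    - intros x Hx. apply W2. nra.
    - exists mu. repeat split; try apply S; auto. lra. }
  destruct (G 0.2 ltac:(lra)) as (f & Sf & Zf & Pf).
  destruct (G 0.6 ltac:(lra)) as (g & Sg & Zg & Pg). clear G.
  assert (Ff : flat f) by (refine (supported_in_flat _ _ _ _ _ _ _ _ _ _ Sf); nra).
  assert (Fg : flat g) by (refine (supported_in_flat _ _ _ _ _ _ _ _ _ _ Sg); nra).
  set (l := fun mu : R -> R => ip (fun x => mu x * phi 1 x) (phi K)).
  assert (Hl : forall a b, l (fun x => a * f x + b * g x) = a * l f + b * l g).
  { intros a b. unfold l. rewrite <- ip_lin_l
      by (apply cont01_smooth; auto using smooth_phi; apply smooth_mult; auto using smooth_phi;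
          first [apply Ff|apply Fg]).
    apply ip_ext. intros; ring. }
  (* A linear functional on a plane has a nonzero vector in its kernel. *)
  assert (X : exists a b, a * l f + b * l g = 0 /\ (a <> 0 \/ b <> 0)).
  { destruct (Req_dec (l f) 0) as [E|E].
    - exists 1, 0. split; [rewrite E; ring|left; lra].
    - exists (- l g), (l f). split; [ring|now right]. }
  destruct X as (a & b & E & Hab).
  set (mu := fun x => a * f x + b * g x).
  assert (AD : forall p, A mu K p = a ^ 2 * A f K p + b ^ 2 * A g K p).
  { intros p. apply A_disjoint; auto.
    eapply (supported_in_disjoint _ _ _ _ _ _ _ _ f g); [| | |exact Sf|exact Sg| | | |]; nra. }
  assert (Smu : supported_in (0.2 * u) (0.7 * u) (1.2 * u) (1.7 * u) mu).
  { apply supported_in_lin; eapply supported_in_sub; [| | | |exact Sf| | | | |exact Sg]; nra. }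
  assert (Fmu : flat mu) by (refine (supported_in_flat _ _ _ _ _ _ _ _ _ _ Smu); nra).
  exists mu. split; [apply Smu|]. split; [|split].
  - exists (0.2 * u), (1.7 * u). repeat split; try nra. intros x Hx. apply off_eq, Smu; nra.
  - unfold H1. fold (l mu). unfold mu. now rewrite Hl.
  - split; [now apply ex_series_weighted_cc|]. split.
    + intros p Hp1 Hp2. rewrite AD, Zf, Zg by lia. ring.
    + rewrite AD. apply Rgt_not_eq.
      assert (0 <= a ^ 2 * A f K n) by (apply Rmult_le_pos; [apply pow2_ge_0|lra]).
      assert (0 <= b ^ 2 * A g K n) by (apply Rmult_le_pos; [apply pow2_ge_0|lra]).
      destruct Hab as [Hc|Hc].
      * assert (0 < a ^ 2 * A f K n) by (apply Rmult_lt_0_compat; [now apply pow2_gt_0|lra]). lra.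
      * assert (0 < b ^ 2 * A g K n) by (apply Rmult_lt_0_compat; [now apply pow2_gt_0|lra]). lra.
Qed.
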